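(* Let $x \in \underline{\Delta}_2$ with $x>0$, $x\notin\Sigma_1$ and $x\notin\Pi_1$ be arbitrary. Let $\sigma_1^2,\sigma_2^2\in\mathbb{R}_c$ with $\sigma_1^2>0$, $\sigma_2^2>0$ be arbitrary but fixed. Then there exist continuous probability density functions $f_{\alpha_1}, f_{\alpha_2}\colon\mathbb{R}\to[0,\infty)$, both computable in $\mathcal{L}^1(\mathbb{R})$, such that for every computable $P>0$ there is a computable number $u(P)\in\mathbb{R}_c$ with $$C_S(P,f_{\alpha_1},f_{\alpha_2},\sigma_1^2,\sigma_2^2) = x + u(P).$$ Consequently, for all $P\in\mathbb{R}_c$ with $P>0$, $C_S(P,f_{\alpha_1},f_{\alpha_2},\sigma_1^2,\sigma_2^2)\in\underline{\Delta}_2$, while $C_S(P,f_{\alpha_1},f_{\alpha_2},\sigma_1^2,\sigma_2^2)\notin\Sigma_1$ and $C_S(P,f_{\alpha_1},f_{\alpha_2},\sigma_1^2,\sigma_2^2)\notin\Pi_1$.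
   Context: $\log$ denotes the logarithm to base $2$ and $\ln$ the natural logarithm. For a power constraint $P>0$, noise powers $\sigma_1^2,\sigma_2^2>0$, and fading probability density functions $f_{\alpha_1},f_{\alpha_2}$ on $\mathbb{R}$, the secrecy capacity of the fast-fading Gaussian wiretap channel (CSI at the receiver only) is $$C_S(P,f_{\alpha_1},f_{\alpha_2},\sigma_1^2,\sigma_2^2)=\int_{-\infty}^{\infty}\log\Big(1+\frac{P\alpha^2}{\sigma_1^2}\Big)f_{\alpha_1}(\alpha)\,d\alpha-\int_{-\infty}^{\infty}\log\Big(1+\frac{P\alpha^2}{\sigma_2^2}\Big)f_{\alpha_2}(\alpha)\,d\alpha.$$ A sequence of rationals $(r_n)$ is computable if $r_n=(-1)^{s(n)}a(n)/b(n)$ for recursive $a,b,s\colon\mathbb{N}\to\mathbb{N}$ with $b(n)\neq0$. A real $x$ is computable ($x\in\mathbb{R}_c$) if there is a computable sequence of rationals $(r_n)$ with $|x-r_n|<2^{-n}$ for all $n$. A sequence of reals $(x_n)$ is computable if there is a computable double sequence of rationals $(r_{m,n})$ with $|r_{m,n}-x_n|\le 2^{-m}$ for all $m,n$. $\Sigma_1$ is the set of reals that are limits of a monotonically nondecreasing computable sequence of rationals; $\Pi_1$ is the set of reals that are limits of a monotonically nonincreasing computable sequence of rationals; $\mathbb{R}_c=\Sigma_1\cap\Pi_1$. $\underline{\Delta}_2$ is the set of reals $x$ for which there exist $a,b\in\Sigma_1$ with $x=a-b$. A function $f$ on a computable interval is computable continuous if it maps computable sequences of reals to computable sequences of reals and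 is effectively uniformly continuous (there is a recursive $d\colon\mathbb{N}\to\mathbb{N}$ with $|x-y|\le 1/d(N)\Rightarrow|f(x)-f(y)|\le 2^{-N}$). A function $f\in\mathcal{L}^1(\mathbb{R})$ is computable in $\mathcal{L}^1(\mathbb{R})$ if there exist a computable sequence $(f_n)$ of computable functions in $\mathcal{L}^1(\mathbb{R})$ and a recursive $e\colon\mathbb{N}\to\mathbb{N}$ with $\|f-f_n\|_1\le 2^{-M}$ for all $n\ge e(M)$. *)

(* Defs.v *)
From HB Require Import structures.
From mathcomp Require Import all_boot all_order all_algebra.
From mathcomp Require Import all_classical all_reals all_analysis.
From mathcomp Require Import Rstruct.
Set Implicit Arguments. Unset Strict Implicit. Unset Printing Implicit Defensive.
Import Order.TTheory GRing.Theory Num.Theory.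
Import numFieldNormedType.Exports.
Local Open Scope classical_set_scope.
Local Open Scope ring_scope.

Inductive code : Type :=
| CZero
| CSucc
| CProj of nat
| CComp of code & list code
| CPrec of code & code
| CMu of code.

Inductive eval : code -> seq nat -> nat -> Prop :=
| eZero v : eval CZero v 0
| eSucc x v : eval CSucc (x :: v) x.+1
| eProj i v : (i < size v)%N -> eval (CProj i) v (nth 0%N v i)
| eComp f gs v ys y : evals gs v ys -> eval f ys y -> eval (CComp f gs) v y
| ePrec0 f g v y : eval f v y -> eval (CPrec f g) (0%N :: v) y
| ePrecS f g n v r y : eval (CPrec f g) (n :: v) r ->
    eval g (n :: r :: v) y -> eval (CPrec f g) (n.+1 :: v) y
| eMu f v n : eval f (n :: v) 0 ->
    (forall m, (m < n)%N -> exists k, eval f (m :: v) k.+1) -> eval (CMu f) v n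
with evals : list code -> seq nat -> seq nat -> Prop :=
| esNil v : evals [::] v [::]
| esCons g gs v y ys : eval g v y -> evals gs v ys -> evals (g :: gs) v (y :: ys).

Definition recursive1 (f : nat -> nat) : Prop :=
  exists c, forall n, eval c [:: n] (f n).
Definition recursive2 (f : nat -> nat -> nat) : Prop :=
  exists c, forall m n, eval c [:: m; n] (f m n).
Definition recursive3 (f : nat -> nat -> nat -> nat) : Prop :=
  exists c, forall m n k, eval c [:: m; n; k] (f m n k).

Section Computability.
Variable R : realType.

Definition ratval (s a b : nat) : R := (-1) ^+ s * a%:R / b%:R.

Definition computable_ratseq (r : nat -> R) : Prop :=
  exists a b s : nat -> nat, [/\ recursive1 a, recursive1 b, recursive1 s,
    (forall n, b n != 0%N) & forall n, r n = ratval (s n) (a n) (b n)].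

Definition computable_ratseq2 (r : nat -> nat -> R) : Prop :=
  exists a b s : nat -> nat -> nat, [/\ recursive2 a, recursive2 b, recursive2 s,
    (forall m n, b m n != 0%N) &
    forall m n, r m n = ratval (s m n) (a m n) (b m n)].

Definition computable_ratseq3 (r : nat -> nat -> nat -> R) : Prop :=
  exists a b s : nat -> nat -> nat -> nat,
    [/\ recursive3 a, recursive3 b, recursive3 s,
    (forall m n k, b m n k != 0%N) &
    forall m n k, r m n k = ratval (s m n k) (a m n k) (b m n k)].

Definition computable_real (x : R) : Prop :=
  exists r, computable_ratseq r /\ forall n, `|x - r n| < 2 ^- n.

Definition computable_realseq (x : nat -> R) : Prop :=
  exists r, computable_ratseq2 r /\ forall m n, `|r m n - x n| <= 2 ^- m.

Definition computable_realseq2 (x : nat -> nat -> R) : Prop :=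
  exists r, computable_ratseq3 r /\ forall m n k, `|r m n k - x n k| <= 2 ^- m.

Definition Sigma1 (x : R) : Prop :=
  exists r, [/\ computable_ratseq r, (forall n, r n <= r n.+1) &
                r n @[n --> \oo] --> x].
Definition Pi1 (x : R) : Prop :=
  exists r, [/\ computable_ratseq r, (forall n, r n.+1 <= r n) &
                r n @[n --> \oo] --> x].
Definition Delta2u (x : R) : Prop :=
  exists a b, [/\ Sigma1 a, Sigma1 b & x = a - b].

(* computable sequence of computable functions R -> R (Pour-El--Richards):
   sequentially computable and effectively uniformly continuous on every
   interval [-M, M], uniformly in the index. *)
Definition computable_funseq (F : nat -> R -> R) : Prop :=
  (forall xs : nat -> R, computable_realseq xs ->
     computable_realseq2 (fun n k => F n (xs k))) /\
  exists d : nat -> nat -> nat -> nat, recursive3 d /\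
    forall n M N, (0 < d n M N)%N /\
    forall x y : R, `|x| <= M%:R -> `|y| <= M%:R ->
      `|x - y| <= (d n M N)%:R^-1 -> `|F n x - F n y| <= 2 ^- N.

Definition L1 (f : R -> R) : Prop :=
  measurable_fun setT f /\
  (lebesgue_measure.-integrable setT (fun x => (f x)%:E)).

Definition computable_L1 (f : R -> R) : Prop :=
  L1 f /\ exists F : nat -> R -> R,
    [/\ computable_funseq F, (forall n, L1 (F n)) &
    exists e : nat -> nat, recursive1 e /\
      forall M n, (e M <= n)%N ->
        (\int[lebesgue_measure]_x (`|f x - F n x|)%:E <= (2 ^- M)%:E)%E].

Definition cont_pdf (f : R -> R) : Prop :=
  [/\ continuous f, (forall x, 0 <= f x), measurable_fun setT f &
      (\int[lebesgue_measure]_x (f x)%:E = 1)%E].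

Definition log2 (y : R) : R := ln y / ln 2.

Definition cap_integrand (P s2 : R) (f : R -> R) (a : R) : R :=
  log2 (1 + P * a ^+ 2 / s2) * f a.

Definition cap_term (P s2 : R) (f : R -> R) : R :=
  fine (\int[lebesgue_measure]_a (cap_integrand P s2 f a)%:E)%E.

(* secrecy capacity of the fast-fading Gaussian wiretap channel *)
Definition C_S (P : R) (f1 f2 : R -> R) (s1 s2 : R) : R :=
  cap_term P s1 f1 - cap_term P s2 f2.

End Computability.

(* Main.v *)
(** The logarithm recovers any [a] in [Sigma1] from a density with effectively
    summable masses. If [r_i] increases to [a] and [q_i = r_(i+1) - r_i], put the
    mass [w_i = q_i / (2 k_i)] on a bump of width 1 at [2 ^ k_i], where
    [k_i = Q 2 ^ i] and [Q] bounds all the [q_i], and the remaining mass on a bump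
    at [1]. As [w_i <= 2 ^ -(i+1)], partial sums converge effectively in [L^1].
    On the bump at [2 ^ k] the integrand [log2 (1 + P x ^ 2 / s)] is [2 k] up to an
    error bounded uniformly in [k], whose mean [excess k] is a computable sequence
    (Riemann sums of a uniformly Lipschitz function). So the capacity
    integral is [sum_i w_i (2 k_i)], that is [a - r_0], plus the computable number
    [(1 - sum_i w_i) excess 0 + sum_i w_i (excess k_i)].
    Applying this to both parts of [x = a - b] gives [C_S = x + u]; [Sigma1] and
    [Pi1] are invariant under adding a computable number. *)
Require Import Defs.
From HB Require Import structures.
From mathcomp Require Import all_boot all_order all_algebra.
From mathcomp Require Import all_classical all_reals all_analysis.
From mathcomp Require Import measurable_realfun Rstruct.
From mathcomp Require Import zify ring lra.
Import Order.TTheory GRing.Theory Num.Theory.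
Import numFieldNormedType.Exports.
Local Open Scope ring_scope.

(** * Recursive functions on vectors *)

Section Recursive.
Local Open Scope nat_scope.
Implicit Types (k j l n m : nat) (v w : seq nat).

(* A [k]-ary function is represented by its values on the sequences of size [k];
   elsewhere it is arbitrary. *)
Definition rec k (f : seq nat -> nat) : Prop :=
  exists c, forall v, size v = k -> Defs.eval c v (f v).

(** A tuple of recursive functions, used for substitution. The size of the output is recorded
    because [rec j] says nothing about sequences of another size. *)
Definition recsub k j (sigma : seq nat -> seq nat) : Prop :=
  exists cs, forall v, size v = k ->
    evals cs v (sigma v) /\ size (sigma v) = j.

Lemma rec_ext {k} (f g : seq nat -> nat) :
  (forall v, size v = k -> f v = g v) -> rec k f -> rec k g.
Proof. by move=> fg [c cP]; exists c => v sv; rewrite -fg//; exact: cP. Qed.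

Lemma rec_subst {k j} f sigma : rec j f -> recsub k j sigma ->
  rec k (fun v => f (sigma v)).
Proof.
move=> [c cP] [cs csP]; exists (CComp c cs) => v sv.
by have [e s] := csP v sv; apply: eComp; [exact: e|exact: cP].
Qed.

Lemma recsub_nil {k} : recsub k 0 (fun=> [::]).
Proof. by exists [::] => v _; split => //; exact: esNil. Qed.

Lemma recsub_cons {k j} g sigma : rec k g -> recsub k j sigma ->
  recsub k j.+1 (fun v => g v :: sigma v).
Proof.
move=> [c cP] [cs csP]; exists (c :: cs) => v sv.
have [e s] := csP v sv; split; last by rewrite /= s.
by apply: esCons => //; exact: cP.
Qed.

(** Stated for an arbitrary suffix so that the induction goes through; [i = 0] gives the identity
    tuple and [i = 1] gives [behead]. *)
Lemma evals_proj v i n : i + n = size v ->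
  evals [seq CProj j | j <- iota i n] v (drop i v).
Proof.
elim: n i => [|n IH] i inv /=.
  by rewrite drop_oversize; [exact: esNil|rewrite -inv addn0].
have iv : i < size v by rewrite -inv addnS ltnS leq_addr.
rewrite (drop_nth 0 iv); apply: esCons; first exact: eProj.
by apply: IH; rewrite -inv addSnnS.
Qed.

Lemma recsub_id {k} : recsub k k id.
Proof.
exists [seq CProj j | j <- iota 0 k] => v sv; split => //.
by have := @evals_proj v 0 k; rewrite drop0 add0n; apply.
Qed.

Lemma recsub_behead {k} : recsub k.+1 k behead.
Proof.
exists [seq CProj j | j <- iota 1 k] => v sv; split; last by rewrite size_behead sv.
by rewrite -drop1; apply: evals_proj; rewrite sv.
Qed.

Lemma recsub_comp {k j l} sigma tau : recsub k j sigma -> recsub j l tau ->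
  recsub k l (fun v => tau (sigma v)).
Proof.
move=> [cs csP] [ct ctP]; exists [seq CComp c cs | c <- ct] => v sv.
have [e s] := csP v sv; have [e' s'] := ctP _ s; split => //.
elim: ct (tau _) e' {ctP s'} => [|c ct IH] t e'; inversion e'; subst.
  exact: esNil.
by apply: esCons; [apply: eComp; [exact: e|]|exact: IH].
Qed.

Lemma rec_nth {k} i : i < k -> rec k (fun v => nth 0 v i).
Proof. by move=> ik; exists (CProj i) => v sv; apply: eProj; rewrite sv. Qed.

Lemma rec_head {k} : rec k.+1 (head 0).
Proof. by apply: rec_ext (rec_nth 0 _) => // -[]. Qed.

Lemma rec_weak {k} f : rec k f -> rec k.+1 (fun w => f (behead w)).
Proof. by move=> rf; apply: rec_subst rf recsub_behead. Qed.

Lemma rec_cst {k} n : rec k (fun=> n).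
Proof.
elim: n => [|n [c cP]]; first by exists CZero => v _; exact: eZero.
exists (CComp CSucc [:: c]) => v sv; apply: eComp (eSucc _ [::]).
by apply: esCons (esNil _); exact: cP.
Qed.

Lemma rec_S {k} f : rec k f -> rec k (fun v => (f v).+1).
Proof.
move=> rf; have rS : rec 1 (fun v => (head 0 v).+1).
  by exists CSucc => -[|x [|y v]]// _; exact: eSucc.
exact: (rec_subst _ (fun v => [:: f v]) rS (recsub_cons _ _ rf recsub_nil)).
Qed.

(** [CPrec] combines the two codes; [g] receives the counter, the previous value and the parameters
    in the order prescribed by [ePrecS]. *)
Lemma rec_prec {k} (F : nat -> seq nat -> nat) (g : nat -> nat -> seq nat -> nat) :
  rec k (F 0) ->
  rec k.+2 (fun w => g (head 0 w) (head 0 (behead w)) (behead (behead w))) ->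
  (forall n v, F n.+1 v = g n (F n v) v) ->
  rec k.+1 (fun w => F (head 0 w) (behead w)).
Proof.
move=> [c cP] [d dP] FS; exists (CPrec c d) => -[//|n v] [sv] /=.
elim: n => [|n IH]; first by apply: ePrec0; exact: cP.
apply: ePrecS; first exact: IH.
by rewrite FS; apply: (dP (n :: F n v :: v)); rewrite /= sv.
Qed.

Lemma rec_app {k} (F : nat -> seq nat -> nat) h :
  rec k.+1 (fun w => F (head 0 w) (behead w)) -> rec k h ->
  rec k (fun v => F (h v) v).
Proof.
move=> rF rh; exact: (rec_subst _ (fun v => h v :: v) rF (recsub_cons _ _ rh recsub_id)).
Qed.

(** Only the recursion equations of [F] are asked for, so a closed form such as [f v + n] is
    directly recognised as an iteration. *)
Lemma rec_iter {k} f h (g : nat -> nat -> seq nat -> nat) (F : nat -> seq nat -> nat) :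
  rec k f ->
  rec k.+2 (fun w => g (head 0 w) (head 0 (behead w)) (behead (behead w))) ->
  rec k h ->
  (forall v, F 0 v = f v) -> (forall n v, F n.+1 v = g n (F n v) v) ->
  rec k (fun v => F (h v) v).
Proof.
move=> rf rg rh F0 FS; apply: rec_app rh; apply: rec_prec rg FS.
by apply: rec_ext rf => v _; rewrite F0.
Qed.

(** * Arithmetic, comparison and case distinction *)

Lemma rec_add {k} f g : rec k f -> rec k g -> rec k (fun v => f v + g v).
Proof.
move=> rf rg.
apply: (@rec_iter k f g (fun _ x _ => x.+1) (fun n v => f v + n)) => //.
- apply: (@rec_S k.+2 (fun w => head 0 (behead w))).
  exact: rec_weak rec_head.
- by move=> v; rewrite addn0.
- by move=> n v; rewrite addnS.
Qed.

Lemma rec_pred {k} f : rec k f -> rec k (fun v => (f v).-1).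
Proof.
move=> rf.
apply: (@rec_iter k (fun=> 0) f (fun n _ _ => n) (fun n _ => n.-1)) => //.
- exact: rec_cst.
- exact: (@rec_head k.+1).
Qed.

Lemma rec_sub {k} f g : rec k f -> rec k g -> rec k (fun v => f v - g v).
Proof.
move=> rf rg.
apply: (@rec_iter k f g (fun _ x _ => x.-1) (fun n v => f v - n)) => //.
- apply: (@rec_pred k.+2 (fun w => head 0 (behead w))).
  exact: rec_weak rec_head.
- by move=> v; rewrite subn0.
- by move=> n v; rewrite subnS.
Qed.

Lemma rec_mul {k} f g : rec k f -> rec k g -> rec k (fun v => f v * g v).
Proof.
move=> rf rg.
apply: (@rec_iter k (fun=> 0) g (fun _ x v => x + f v) (fun n v => f v * n)) => //.
- exact: rec_cst.
- apply: (@rec_add k.+2 (fun w => head 0 (behead w)) (fun w => f (behead (behead w)))).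
    exact: rec_weak rec_head.
  exact/(rec_weak (fun w => f (behead w)))/rec_weak.
- by move=> v; rewrite muln0.
- by move=> n v; rewrite mulnSr.
Qed.

Lemma rec_bigsum {k} f h :
  rec k.+1 (fun w => f (head 0 w) (behead w)) -> rec k h ->
  rec k (fun v => \sum_(i < h v) f i v).
Proof.
move=> rf rh.
apply: (@rec_iter k (fun=> 0) h (fun n x v => x + f n v) (fun n v => \sum_(i < n) f i v)) => //.
- exact: rec_cst.
- apply: (@rec_add k.+2 (fun w => head 0 (behead w)) (fun w => f (head 0 w) (behead (behead w)))).
    exact: rec_weak rec_head.
  (* The accumulator, second entry of the vector, is dropped before [f] is applied. *)
  apply: (rec_subst _ (fun w => head 0 w :: behead (behead w)) rf).
  apply: recsub_cons; first exact: rec_head.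
  exact: recsub_comp recsub_behead recsub_behead.
- by move=> v; rewrite big_ord0.
- by move=> n v; rewrite big_ord_recr.
Qed.

Lemma rec_bigprod {k} f h :
  rec k.+1 (fun w => f (head 0 w) (behead w)) -> rec k h ->
  rec k (fun v => \prod_(i < h v) f i v).
Proof.
move=> rf rh.
apply: (@rec_iter k (fun=> 1) h (fun n x v => x * f n v) (fun n v => \prod_(i < n) f i v)) => //.
- exact: rec_cst.
- apply: (@rec_mul k.+2 (fun w => head 0 (behead w)) (fun w => f (head 0 w) (behead (behead w)))).
    exact: rec_weak rec_head.
  apply: (rec_subst _ (fun w => head 0 w :: behead (behead w)) rf).
  apply: recsub_cons; first exact: rec_head.
  exact: recsub_comp recsub_behead recsub_behead.
- by move=> v; rewrite big_ord0.
- by move=> n v; rewrite big_ord_recr.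
Qed.

Lemma rec_exp {k} f g : rec k f -> rec k g -> rec k (fun v => f v ^ g v).
Proof.
move=> rf rg; apply: rec_ext (rec_bigprod (fun _ v => f v) g _ rg).
  by move=> v _; rewrite prod_nat_const card_ord.
exact: rec_weak.
Qed.

(** With truncated subtraction, [1 - (f v - g v)] is the indicator of the comparison. *)
Lemma rec_leq {k} f g : rec k f -> rec k g -> rec k (fun v => (f v <= g v) : nat).
Proof.
move=> rf rg; apply: rec_ext (rec_sub (fun=> 1) _ (rec_cst 1) (rec_sub _ _ rf rg)).
by move=> v _ /=; rewrite -subn_eq0; case: (f v - g v).
Qed.

Lemma rec_odd {k} f : rec k f -> rec k (fun v => odd (f v) : nat).
Proof.
move=> rf.
apply: (@rec_iter k (fun=> 0) f (fun _ x _ => 1 - x) (fun n _ => odd n : nat)) => //.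
- exact: rec_cst.
- apply: (@rec_sub k.+2 (fun=> 1) (fun w => head 0 (behead w))).
    exact: rec_cst.
  exact: rec_weak rec_head.
- by move=> n v /=; case: (odd n).
Qed.

Lemma rec_if {k} (b : seq nat -> bool) f g :
  rec k (fun v => b v : nat) -> rec k f -> rec k g ->
  rec k (fun v => if b v then f v else g v).
Proof.
move=> rb rf rg.
apply: rec_ext (rec_add _ _ (rec_mul _ _ rb rf)
  (rec_mul _ _ (rec_sub _ _ (rec_cst 1) rb) rg)) => v _ /=.
by case: (b v); rewrite /= ?mul1n ?mul0n ?addn0.
Qed.

End Recursive.

(** * Computable reals *)

(* The bound variable of an iteration is the head of the vector, as in de Bruijn's
   convention. *)
Local Notation unc f := (fun w => f (head 0%N w) (behead w)).

Ltac rec_auto := repeat match goal with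
  | |- rec _ (fun=> ?c) => exact: rec_cst
  | |- rec _ (head _) => exact: rec_head
  | |- rec _ (fun v => (_ + _)%N) => apply: rec_add
  | |- rec _ (fun v => (_ - _)%N) => apply: rec_sub
  | |- rec _ (fun v => (_ * _)%N) => apply: rec_mul
  | |- rec _ (fun v => (_ ^ _)%N) => apply: rec_exp
  | |- rec _ (fun v => (_ .+1)%N) => apply: rec_S
  | |- rec _ (fun v => nat_of_bool (leq _ _)) => apply: rec_leq
  | |- rec _ (fun v => nat_of_bool (odd _)) => apply: rec_odd
  | |- rec _ (fun v => if _ then _ else _) => apply: rec_if
  | |- rec _ (fun v => ?f (behead v)) => apply: (rec_weak f)
  | H : rec ?k ?f |- rec ?k ?f => exact: H
  | |- recsub _ _ (fun=> [::]) => exact: recsub_nil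
  | |- recsub _ _ (fun v => v) => exact: recsub_id
  | |- recsub _ _ behead => exact: recsub_behead
  | |- recsub _ _ (fun v => _ :: _) => apply: recsub_cons
  | |- recsub _ _ (fun v => behead (behead v)) =>
       exact: (recsub_comp behead behead recsub_behead recsub_behead)
  end.

Section ComputableReals.
Variable R : realType.
Implicit Types (k j n m : nat) (v w : seq nat) (r : seq nat -> R).

(* Numerators are differences of naturals, so that no sign has to be computed. *)
Definition RQ k (r : seq nat -> R) : Prop :=
  exists p q d : seq nat -> nat, [/\ rec k p, rec k q, rec k d,
    (forall v, d v != 0%N) &
    forall v, size v = k -> r v = ((p v)%:R - (q v)%:R) / (d v)%:R].

Lemma RQ_ext {k} r1 r2 : (forall v, size v = k -> r1 v = r2 v) -> RQ k r1 -> RQ k r2.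
Proof.
move=> r12 [p [q [d [rp rq rd d0 rE]]]]; exists p, q, d; split => // v sv.
by rewrite -r12// rE.
Qed.

Lemma RQ_subst {k j} r sigma : RQ j r -> recsub k j sigma -> RQ k (fun v => r (sigma v)).
Proof.
move=> [p [q [d [rp rq rd d0 rE]]]] rs.
exists (fun v => p (sigma v)), (fun v => q (sigma v)), (fun v => d (sigma v)).
split => //; try exact: rec_subst rs.
by move=> v sv; apply: rE; case: rs => cs /(_ v sv)[].
Qed.

Lemma RQ_weak {k} r : RQ k r -> RQ k.+1 (fun w => r (behead w)).
Proof. by move=> rr; apply: RQ_subst rr recsub_behead. Qed.

Lemma RQ_app {k} (r : nat -> seq nat -> R) h : RQ k.+1 (unc r) -> rec k h ->
  RQ k (fun v => r (h v) v).
Proof.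
move=> rr rh; exact: (RQ_subst _ (fun v => h v :: v) rr (recsub_cons _ _ rh recsub_id)).
Qed.

Lemma RQ_nat {k} f : rec k f -> RQ k (fun v => (f v)%:R).
Proof.
move=> rf; exists f, (fun=> 0%N), (fun=> 1%N); split => //; rec_auto.
by move=> v _; rewrite subr0 divr1.
Qed.

Lemma RQ_add {k} r1 r2 : RQ k r1 -> RQ k r2 -> RQ k (fun v => r1 v + r2 v).
Proof.
move=> [p [q [d [rp rq rd d0 rE]]]] [p' [q' [d' [rp' rq' rd' d0' rE']]]].
exists (fun v => p v * d' v + p' v * d v)%N, (fun v => q v * d' v + q' v * d v)%N,
  (fun v => d v * d' v)%N; split; rec_auto.
- by move=> v; rewrite muln_eq0 negb_or d0 d0'.
- move=> v sv; rewrite rE// rE'// !natrD !natrM.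
  have h : (d v)%:R != 0 :> R by rewrite pnatr_eq0.
  have h' : (d' v)%:R != 0 :> R by rewrite pnatr_eq0.
  by field; rewrite h h'.
Qed.

Lemma RQ_opp {k} r : RQ k r -> RQ k (fun v => - r v).
Proof.
move=> [p [q [d [rp rq rd d0 rE]]]]; exists q, p, d; split => // v sv.
by rewrite rE// -mulNr opprB.
Qed.

Lemma RQ_mul {k} r1 r2 : RQ k r1 -> RQ k r2 -> RQ k (fun v => r1 v * r2 v).
Proof.
move=> [p [q [d [rp rq rd d0 rE]]]] [p' [q' [d' [rp' rq' rd' d0' rE']]]].
exists (fun v => p v * p' v + q v * q' v)%N, (fun v => p v * q' v + q v * p' v)%N,
  (fun v => d v * d' v)%N; split; rec_auto.
- by move=> v; rewrite muln_eq0 negb_or d0 d0'.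
- move=> v sv; rewrite rE// rE'// !natrD !natrM.
  have h : (d v)%:R != 0 :> R by rewrite pnatr_eq0.
  have h' : (d' v)%:R != 0 :> R by rewrite pnatr_eq0.
  by field; rewrite h h'.
Qed.

(** The sign of [p v - q v] decides which numerator receives [d v]. If [p v = q v], both numerators
    are [0] over the denominator [1], in agreement with the convention that the inverse of [0] is
    [0]. *)
Lemma RQ_inv {k} r : RQ k r -> RQ k (fun v => (r v)^-1).
Proof.
move=> [p [q [d [rp rq rd d0 rE]]]].
exists (fun v => if (p v <= q v)%N then 0%N else d v),
  (fun v => if (q v <= p v)%N then 0%N else d v),
  (fun v => if (p v <= q v)%N then if (q v <= p v)%N then 1%N else q v - p v else p v - q v)%N.
split; rec_auto.
- by move=> v; case: ltngtP; lia.
- move=> v sv; rewrite rE// invf_div; case: ltngtP => h.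
  + by rewrite natrB 1?ltnW// sub0r -opprB invrN mulrN mulNr.
  + by rewrite natrB 1?ltnW// subr0.
  + by rewrite h !subrr invr0 mulr0 mul0r.
Qed.

(** Truncated subtraction of the two numerators is exactly the positive part. *)
Lemma RQ_max0 {k} r : RQ k r -> RQ k (fun v => Num.max 0 (r v)).
Proof.
move=> [p [q [d [rp rq rd d0 rE]]]].
exists (fun v => p v - q v)%N, (fun=> 0%N), d; split => //; rec_auto.
move=> v sv; rewrite rE// subr0.
have d1 : 0 < (d v)%:R^-1 :> R by rewrite invr_gt0 ltr0n lt0n.
case: (leqP (q v) (p v)) => h.
  by rewrite natrB// max_r// mulr_ge0 ?(ltW d1)// subr_ge0 ler_nat.
rewrite (eqP (ltnW h)) mul0r max_l// mulr_le0_ge0 ?(ltW d1)//.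
by rewrite subr_le0 ler_nat ltnW.
Qed.

Lemma RQ_sum {k} (r : nat -> seq nat -> R) h : RQ k.+1 (unc r) -> rec k h ->
  RQ k (fun v => \sum_(i < h v) r i v).
Proof.
move=> [p [q [d [rp rq rd d0 rE]]]] rh.
(* [D] is a common denominator. [E i] is the same product with the factor of index [i] replaced by
   [1], so the numerators over [D] are found without dividing. *)
pose D n v := (\prod_(i < n) d (nat_of_ord i :: v))%N.
pose E (i n : nat) v := (\prod_(j < n) if (i == j :> nat) then 1%N else d (nat_of_ord j :: v))%N.
have rE' : rec k.+2 (fun w => E (head 0%N w) (head 0%N (behead w)) (behead (behead w))).
  apply: (rec_bigprod (fun j w => if (head 0%N w == j) then 1%N else d (j :: behead (behead w)))).
    apply: (rec_if (fun w => head 0%N (behead w) == head 0%N w)).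
    - apply: (rec_ext (fun v => (head 0%N v <= head 0%N (behead v)) *
         (head 0%N (behead v) <= head 0%N v)))%N.
        by move=> v _; rewrite mulnb andbC eqn_leq.
      by rec_auto.
    - exact: rec_cst.
    - apply: (rec_subst _ (fun w => head 0%N w :: behead (behead (behead w))) rd).
      apply: recsub_cons; first exact: rec_head.
      exact: (recsub_comp behead (fun w => behead (behead w)) recsub_behead
        (recsub_comp behead behead recsub_behead recsub_behead)).
  exact/rec_weak/rec_head.
have rnum (a : seq nat -> nat) : rec k.+1 a ->
    rec k (fun v => \sum_(i < h v) a (nat_of_ord i :: v) * E i (h v) v)%N.
  move=> ra; apply: (rec_bigsum (fun i v => a (i :: v) * E i (h v) v)%N) => //.
  apply: rec_mul.
    by apply: rec_ext ra => -[].
  apply: (rec_subst _ (fun w => head 0%N w :: h (behead w) :: behead w) rE').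
  by rec_auto.
exists (fun v => \sum_(i < h v) p (nat_of_ord i :: v) * E i (h v) v)%N,
  (fun v => \sum_(i < h v) q (nat_of_ord i :: v) * E i (h v) v)%N, (fun v => D (h v) v).
split; try exact: rnum.
- apply: (rec_bigprod (fun i v => d (i :: v))) => //.
  by apply: rec_ext rd => -[].
- by move=> v; rewrite -lt0n prodn_gt0// => i; rewrite lt0n.
- move=> v sv; rewrite !natr_sum -sumrB mulr_suml; apply: eq_bigr => i _.
  have := rE (nat_of_ord i :: v); rewrite /= sv => ->//.
  rewrite !natrM -mulrBl.
  have DE : D (h v) v = (E i (h v) v * d (nat_of_ord i :: v))%N.
    rewrite /D /E (bigD1 i)//= mulnC; congr (_ * _)%N.
    rewrite [RHS](bigD1 i)//= eqxx mul1n; apply: eq_bigr => j ji.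
    by rewrite (_ : (_ == _) = false)//; apply/negbTE; rewrite eq_sym.
  have E0 : (E i (h v) v)%:R != 0 :> R.
    rewrite pnatr_eq0 -lt0n prodn_gt0// => j; case: ifP => // _.
    by rewrite lt0n.
  have h0 : (d (nat_of_ord i :: v))%:R != 0 :> R by rewrite pnatr_eq0.
  by rewrite DE natrM; field; rewrite E0 h0.
Qed.

Lemma RQ_pow2N {k} f : rec k f -> RQ k (fun v => 2 ^- f v).
Proof.
move=> rf; apply: RQ_ext (RQ_inv _ (RQ_nat (fun v => 2 ^ f v)%N _)); last by rec_auto.
by move=> v _; rewrite natrX.
Qed.

(** * Passage between [RQ] and the sign-and-quotient encoding *)

Lemma RQ_ratseq (r : nat -> R) : computable_ratseq r -> RQ 1 (fun v => r (head 0%N v)).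
Proof.
move=> [a [b [s [[ca aP] [cb bP] [cs sP] b0 rE]]]].
have H (f : nat -> nat) c : (forall n, Defs.eval c [:: n] (f n)) -> rec 1 (fun v => f (head 0%N v)).
  by move=> fP; exists c => -[|n []].
have := (H a ca aP, H b cb bP, H s cs sP) => -[[ra rb] rs].
exists (fun v => if odd (s (head 0%N v)) then 0%N else a (head 0%N v)),
  (fun v => if odd (s (head 0%N v)) then a (head 0%N v) else 0%N), (fun v => b (head 0%N v)).
split => //; rec_auto.
by move=> v _; rewrite rE /ratval -signr_odd; case: odd;
  rewrite ?expr0 ?expr1 ?mulN1r ?mul1r ?sub0r ?subr0.
Qed.

Lemma RQ_ratseq2 (r : nat -> nat -> R) : computable_ratseq2 r ->
  RQ 2 (fun v => r (head 0%N v) (head 0%N (behead v))).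
Proof.
move=> [a [b [s [[ca aP] [cb bP] [cs sP] b0 rE]]]].
have H (f : nat -> nat -> nat) c : (forall m n, Defs.eval c [:: m; n] (f m n)) ->
   rec 2 (fun v => f (head 0%N v) (head 0%N (behead v))).
  by move=> fP; exists c => -[|m [|n []]].
have := (H a ca aP, H b cb bP, H s cs sP) => -[[ra rb] rs].
exists (fun v => if odd (s (head 0%N v) (head 0%N (behead v))) then 0%N
    else a (head 0%N v) (head 0%N (behead v))),
  (fun v => if odd (s (head 0%N v) (head 0%N (behead v)))
    then a (head 0%N v) (head 0%N (behead v)) else 0%N),
  (fun v => b (head 0%N v) (head 0%N (behead v))).
split => //; rec_auto.
by move=> v _; rewrite rE /ratval -signr_odd; case: odd;
  rewrite ?expr0 ?expr1 ?mulN1r ?mul1r ?sub0r ?subr0.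
Qed.

Lemma RQ_ratval {k} r : RQ k r -> exists a b s, [/\ rec k a, rec k b, rec k s,
  (forall v, b v != 0%N) & forall v, size v = k -> r v = ratval R (s v) (a v) (b v)].
Proof.
move=> [p [q [d [rp rq rd d0 rE]]]].
(* One of the two truncated differences vanishes, so their sum is the absolute difference. The sign
   exponent is also [1] when [p v = q v], where the numerator is [0]. *)
exists (fun v => (p v - q v) + (q v - p v))%N, d, (fun v => (p v <= q v)%N : nat).
split => //; rec_auto.
move=> v sv; rewrite rE// /ratval; case: leqP => h.
  rewrite expr1 mulN1r (eqP h) add0n natrB//; by rewrite opprB.
by rewrite expr0 mul1r (eqP (ltnW h)) addn0 natrB// ltnW.
Qed.

Lemma ratseq_RQ r : RQ 1 r -> computable_ratseq (fun n => r [:: n]).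
Proof.
move=> /RQ_ratval[a [b [s [[ca aP] [cb bP] [cs sP] b0 rE]]]].
exists (fun n => a [:: n]), (fun n => b [:: n]), (fun n => s [:: n]); split => //.
- by exists ca => n; apply: aP.
- by exists cb => n; apply: bP.
- by exists cs => n; apply: sP.
- by move=> n; apply: rE.
Qed.

Lemma ratseq3_RQ r : RQ 3 r -> computable_ratseq3 (fun m n l => r [:: m; n; l]).
Proof.
move=> /RQ_ratval[a [b [s [[ca aP] [cb bP] [cs sP] b0 rE]]]].
exists (fun m n l => a [:: m; n; l]), (fun m n l => b [:: m; n; l]), (fun m n l => s [:: m; n; l]).
split => //.
- by exists ca => m n l; apply: aP.
- by exists cb => m n l; apply: bP.
- by exists cs => m n l; apply: sP.
- by move=> m n l; apply: rE.
Qed.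

(** Families of reals computable uniformly in a vector, the precision being an additional leading
    argument: [k = 0] describes a single computable real, [k = 1] a computable sequence. *)
Definition CR k (x : seq nat -> R) : Prop :=
  exists r : nat -> seq nat -> R, RQ k.+1 (unc r) /\
    forall m v, size v = k -> `|r m v - x v| <= 2 ^- m.

Lemma CR_ext {k} x y : (forall v, size v = k -> x v = y v) -> CR k x -> CR k y.
Proof. by move=> xy [r [rr rE]]; exists r; split => // m v sv; rewrite -xy// rE. Qed.

Lemma pow2N_ge0 n : 0 <= 2 ^- n :> R.
Proof. by rewrite invr_ge0 exprn_ge0. Qed.

Lemma pow2N_gt0 n : 0 < 2 ^- n :> R.
Proof. by rewrite invr_gt0 exprn_gt0. Qed.

Lemma pow2NS n : 2 ^- n.+1 = 2 ^- n / 2 :> R.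
Proof. by rewrite exprSr invfM. Qed.

(** Since [K < 2 ^ K], raising the precision by [K] absorbs an error factor [K]. Sums, products and
    Lipschitz maps all choose their precision this way. *)
Lemma pow2N_mul n K : K%:R * 2 ^- (n + K) <= 2 ^- n :> R.
Proof.
rewrite exprD invfM mulrCA ler_piMr ?pow2N_ge0// ler_pdivrMr ?exprn_gt0// mul1r.
by rewrite -natrX ler_nat ltnW// ltn_expl.
Qed.

Lemma CR_RQ {k} r : RQ k r -> CR k r.
Proof.
move=> rr; exists (fun _ v => r v); split; first exact: RQ_weak.
by move=> m v _; rewrite subrr normr0 pow2N_ge0.
Qed.

Lemma CR_subst {k j} x sigma : CR j x -> recsub k j sigma -> CR k (fun v => x (sigma v)).
Proof.
move=> [r [rr rE]] rs; exists (fun m v => r m (sigma v)); split.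
  apply: (RQ_subst _ (fun w => head 0%N w :: sigma (behead w)) rr).
  apply: recsub_cons; first exact: rec_head.
  exact: recsub_comp recsub_behead rs.
by move=> m v sv; apply: rE; case: rs => cs /(_ v sv)[].
Qed.

Lemma RQ_prec {k} (r : nat -> seq nat -> R) g : RQ k.+1 (unc r) -> rec k.+1 (unc g) ->
  RQ k.+1 (unc (fun m v => r (g m v) v)).
Proof.
move=> rr rg; apply: (RQ_subst _ (fun w => g (head 0%N w) (behead w) :: behead w) rr).
by apply: recsub_cons => //; exact: recsub_behead.
Qed.

Lemma CR_add {k} x y : CR k x -> CR k y -> CR k (fun v => x v + y v).
Proof.
move=> [r [rr rE]] [s [rs sE]]; exists (fun m v => r m.+1 v + s m.+1 v); split.
  by apply: RQ_add; apply: (RQ_prec _ (fun m _ => m.+1)) => //; rec_auto.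
move=> m v sv; have := rE m.+1 v sv; have := sE m.+1 v sv.
rewrite pow2NS; move: (2 ^- m) => e; rewrite !ler_norml => /andP[? ?] /andP[? ?].
by apply/andP; split; lra.
Qed.

Lemma CR_opp {k} x : CR k x -> CR k (fun v => - x v).
Proof.
move=> [r [rr rE]]; exists (fun m v => - r m v); split; first exact: RQ_opp.
by move=> m v sv; rewrite -opprD normrN rE.
Qed.

(** The approximation at precision [0] is within [1] of [x v], and its absolute value is at most
    [p v + q v] because the denominator is at least [1]. *)
Lemma CR_bound {k} x : CR k x ->
  exists K, rec k K /\ forall v, size v = k -> `|x v| <= (K v)%:R.
Proof.
move=> [r [rr rE]]; have [p [q [d [rp rq rd d0 rE']]]] := RQ_app r (fun=> 0%N) rr (rec_cst _).
exists (fun v => p v + q v + 1)%N; split; first by rec_auto.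
move=> v sv; have := rE 0%N v sv; rewrite expr0 invr1 rE'// !natrD distrC => h.
have e : `|((p v)%:R - (q v)%:R) / (d v)%:R| <= (p v)%:R + (q v)%:R :> R.
  rewrite normrM normfV ler_pdivrMr; last by rewrite normr_gt0 pnatr_eq0.
  rewrite (le_trans (ler_normB _ _))// !normr_nat ler_peMr ?addr_ge0//.
  by rewrite ler1n lt0n.
by move: (_ / _) e h => z e h; rewrite -[x v](subrK z) (le_trans (ler_normD _ _))// addrC lerD.
Qed.

Lemma CR_mul {k} x y : CR k x -> CR k y -> CR k (fun v => x v * y v).
Proof.
move=> cx cy; have [K [rK xK]] := CR_bound _ cx; have [L [rL yL]] := CR_bound _ cy.
move: cx cy => [r [rr rE]] [s [rs sE]].
pose g m v := (m + (K v + L v + 1))%N.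
exists (fun m v => r (g m v) v * s (g m v) v); split.
  by apply: RQ_mul; apply: RQ_prec => //; rewrite /g; rec_auto.
move=> m v sv; have := rE (g m v) v sv; have := sE (g m v) v sv.
have := pow2N_mul m (K v + L v + 1); rewrite -/(g m v).
have e1 : 2 ^- g m v <= 1 :> R by rewrite invf_le1 ?exprn_gt0// exprn_ege1// ler1n.
have := pow2N_ge0 (g m v); move: (2 ^- g m v) e1 => e e1 e0.
move: (r _ v) (s _ v) => a b; rewrite !natrD => H hb ha.
have hb' : `|b| <= (L v)%:R + 1.
  rewrite -[b](subrK (y v)) (le_trans (ler_normD _ _))// addrC lerD ?yL//.
  exact: le_trans hb e1.
(* The first summand costs [e * (L v + 1)] and the second [K v * e], which explains the shift in
   [g]. *)
rewrite (_ : a * b - _ = (a - x v) * b + x v * (b - y v)); last by ring.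
apply: le_trans H; apply: (le_trans (ler_normD _ _)); rewrite !normrM.
rewrite (_ : (_ + _ + 1) * e = e * ((L v)%:R + 1) + (K v)%:R * e); last by ring.
by apply: lerD; apply: ler_pM => //; exact: xK.
Qed.

(** Diagonal argument: the term of index [m.+1], itself approximated to precision [m.+1], splits the
    error into two halves. *)
Lemma CR_lim {k} (y : nat -> seq nat -> R) x : CR k.+1 (unc y) ->
  (forall n v, size v = k -> `|y n v - x v| <= 2 ^- n) -> CR k x.
Proof.
move=> [r [rr rE]] yx; exists (fun m v => r m.+1 (m.+1 :: v)); split.
  apply: (RQ_subst _ (fun w => (head 0%N w).+1 :: (head 0%N w).+1 :: behead w) rr).
  by rec_auto.
move=> m v sv; have := rE m.+1 (m.+1 :: v); rewrite /= sv => /(_ erefl).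
have := yx m.+1 v sv; rewrite pow2NS; move: (2 ^- m) => e.
rewrite !ler_norml => /andP[? ?] /andP[? ?].
by apply/andP; split; lra.
Qed.

Lemma CR_sum {k} (x : nat -> seq nat -> R) h : CR k.+1 (unc x) -> rec k h ->
  CR k (fun v => \sum_(i < h v) x i v).
Proof.
move=> [r [rr rE]] rh.
exists (fun m v => \sum_(i < h v) r (m + h v)%N (nat_of_ord i :: v)); split.
  apply: (RQ_sum (fun i w => r (head 0%N w + h (behead w))%N (i :: behead w))
    (fun w => h (behead w))); last by rec_auto.
  apply: (RQ_subst _ (fun w => (head 0%N (behead w) + h (behead (behead w)))%N ::
     head 0%N w :: behead (behead w)) rr).
  by rec_auto; apply: (rec_weak (fun w => h (behead w))); rec_auto.
move=> m v sv; rewrite -sumrB (le_trans (ler_norm_sum _ _ _))//.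
apply: le_trans (pow2N_mul m (h v)).
rewrite -[X in X%:R * _]card_ord mulr_natl -sumr_const; apply: ler_sum => i _.
by apply: (rE _ (nat_of_ord i :: v)); rewrite /= sv.
Qed.

(** It suffices to compute [phi] at rational arguments: a Lipschitz bound controls the error made in
    replacing [x] by its approximations. *)
Lemma CR_lipschitz {k} (phi : R -> R) K x :
  (forall s t, `|phi s - phi t| <= K%:R * `|s - t|) ->
  (forall j r, RQ j r -> CR j (fun v => phi (r v))) ->
  CR k x -> CR k (fun v => phi (x v)).
Proof.
move=> lip phiRQ [r [rr rE]].
apply: (CR_lim (fun n v => phi (r (n + K)%N v))).
  by apply: phiRQ; apply: (RQ_prec r (fun n _ => n + K)%N) => //; rec_auto.
move=> n v sv; apply: le_trans (lip _ _) _; apply: le_trans (pow2N_mul n K).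
by rewrite ler_wpM2l// rE.
Qed.

Lemma max0B_lipschitz (c s t : R) :
  `|Num.max 0 (s - c) - Num.max 0 (t - c)| <= `|s - t|.
Proof.
wlog st : s t / t <= s => [H|].
  by case: (leP t s) => h; [exact: H|rewrite distrC [leRHS]distrC H// ltW].
rewrite [leRHS]ger0_norm ?subr_ge0// ler_norml /Num.max.
by case: ltP => h1; case: ltP => h2; apply/andP; split; lra.
Qed.

Lemma CR_inv {k} D x : (forall v, size v = k -> D.+1%:R^-1 <= x v) -> CR k x ->
  CR k (fun v => (x v)^-1).
Proof.
(* Clamping the argument from below at [1 / D.+1] leaves the values at [x v] unchanged and makes the
   inverse globally Lipschitz, with constant [D.+1 * D.+1]; approximations of [x v] may fall below
   the bound. *)
move=> xD cx; pose phi (t : R) := (D.+1%:R^-1 + Num.max 0 (t - D.+1%:R^-1))^-1.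
have d0 : 0 < D.+1%:R^-1 :> R by rewrite invr_gt0.
apply: (CR_ext (fun v => phi (x v))).
  by move=> v sv; rewrite /phi max_r ?subr_ge0 ?xD// addrC subrK.
apply: (CR_lipschitz _ (D.+1 * D.+1)%N) => //.
  move=> s t; rewrite /phi; set c := D.+1%:R^-1 in d0 *.
  have -> : (D.+1 * D.+1)%:R = c^-1 * c^-1 by rewrite /c natrM invrK.
  have hm u : 0 <= Num.max 0 (u - c) by rewrite le_max lexx.
  have : `|Num.max 0 (s - c) - Num.max 0 (t - c)| <= `|s - t|.
    exact: max0B_lipschitz.
  have := hm s; have := hm t; move: (Num.max 0 (s - c)) (Num.max 0 (t - c)) => b a a0 b0 h.
  have ca : 0 < c + a by rewrite ltr_wpDr.
  have cb : 0 < c + b by rewrite ltr_wpDr.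
  rewrite (_ : (c + b)^-1 - _ = (c + b)^-1 * (c + a)^-1 * (a - b)); last first.
    by field; rewrite !gt_eqF.
  rewrite normrM [`|a - b|]distrC ler_pM ?normr_ge0// ger0_norm; last first.
    by rewrite mulr_ge0// invr_ge0 ltW.
  by rewrite ler_pM ?invr_ge0 ?(ltW ca) ?(ltW cb)// lef_pV2 ?posrE// lerDl.
move=> j r rr; apply: CR_RQ; apply: RQ_inv.
have rc : RQ j (fun=> D.+1%:R^-1) by apply: RQ_inv; apply: RQ_nat; rec_auto.
apply: RQ_add => //; apply: RQ_max0; apply: RQ_add => //; exact: RQ_opp.
Qed.

(** * Computing the logarithm *)

Lemma ln_le_subr1 (x : R) : 0 < x -> ln x <= x - 1.
Proof. by move=> x0; have := @le_ln1Dx R (x - 1); rewrite (addrC 1) subrK; apply; lra. Qed.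

Lemma ln_sub_bound (a b : R) : 0 < a -> 0 < b -> ln a - ln b <= (a - b) / b.
Proof.
move=> a0 b0; rewrite -ln_div ?posrE// mulrBl divff ?gt_eqF//.
by apply: ln_le_subr1; rewrite divr_gt0.
Qed.

(** With [k = M + n], one more term adds [1 / k - (ln (k + 1) - ln k)], which lies between [0] and
    [1 / k - 1 / (k + 1)]; these bounds telescope. For [M = 2 ^ m] and [M + n = f * 2 ^ m] the
    rational sum approximates [ln f] to within [2 ^- m]. *)
Lemma harmonic_ln (M n : nat) : (0 < M)%N ->
  let d : R := \sum_(i < n) (M + i)%:R^-1 - (ln (M + n)%:R - ln M%:R) in
  0 <= d <= M%:R^-1 - (M + n)%:R^-1.
Proof.
move=> M0; elim: n => [|n] /=; first by rewrite big_ord0 addn0 !subrr lexx.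
have k0 : 0 < (M + n)%:R :> R by rewrite ltr0n addn_gt0 M0.
have k1 : 0 < (M + n.+1)%:R :> R by rewrite ltr0n addn_gt0 M0.
have := ln_sub_bound _ _ k0 k1; have := ln_sub_bound _ _ k1 k0.
have -> : (M + n.+1)%:R = (M + n)%:R + 1 :> R by rewrite addnS natr1.
have -> : (M + n)%:R + 1 - (M + n)%:R = 1 :> R by lra.
have -> : (M + n)%:R - ((M + n)%:R + 1) = -1 :> R by lra.
rewrite mul1r mulN1r big_ord_recr /=.
move: (ln _) (ln _) (_^-1) (_^-1) (_^-1) (\sum_(_ < _) _) => l1 l2 i1 i2 i3 S.
by move=> ? ? /andP[? ?]; apply/andP; split; lra.
Qed.

(* At [f v = 0] the junk value [ln 0 = 0] is the value of the empty sum. *)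
Lemma CR_ln_nat {k} f : rec k f -> CR k (fun v => ln (f v)%:R).
Proof.
move=> rf; exists (fun m v => \sum_(i < f v * 2 ^ m - 2 ^ m) (2 ^ m + i)%:R^-1); split.
  apply: (RQ_sum (fun i w => (2 ^ head 0 w + i)%N%:R^-1)
    (fun w => f (behead w) * 2 ^ head 0 w - 2 ^ head 0 w)%N); last by rec_auto.
  by apply: RQ_inv; apply: RQ_nat; rec_auto.
move=> m v _; have [->|f0] := posnP (f v).
  by rewrite mul0n sub0n big_ord0 ln0// subrr normr0 pow2N_ge0.
have e0 : (0 < 2 ^ m)%N by rewrite expn_gt0.
have /= := harmonic_ln (2 ^ m) (f v * 2 ^ m - 2 ^ m) e0.
rewrite subnKC; last by rewrite leq_pmull.
rewrite natrM lnM ?posrE ?ltr0n// addrK => /andP[h1 h2].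
rewrite ger0_norm// (le_trans h2)// natrX lerBlDr lerDl invr_ge0.
by rewrite mulr_ge0// exprn_ge0.
Qed.

Lemma ln_lipschitz (s t : R) : 1 <= s -> 1 <= t -> `|ln s - ln t| <= `|s - t|.
Proof.
wlog st : s t / t <= s => [H|] s1 t1.
  by case: (leP t s) => h; [exact: H|rewrite distrC [leRHS]distrC H// ltW].
rewrite !ger0_norm ?subr_ge0// ?ler_ln ?posrE//; try lra.
apply: (le_trans (ln_sub_bound _ _ _ _)); try lra.
by rewrite ler_pdivrMr; [rewrite ler_peMr// subr_ge0|lra].
Qed.

Lemma CR_ln {k} x : (forall v, size v = k -> 1 <= x v) -> CR k x -> CR k (fun v => ln (x v)).
Proof.
move=> x1 cx; pose phi (t : R) := ln (1 + Num.max 0 (t - 1)).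
apply: (CR_ext (fun v => phi (x v))).
  by move=> v sv; rewrite /phi max_r ?subr_ge0 ?x1// addrC subrK.
apply: (CR_lipschitz _ 1%N) => //.
  move=> s t; rewrite /phi mul1r.
  have hm u : 1 <= 1 + Num.max 0 (u - 1) :> R by rewrite lerDl le_max lexx.
  apply: le_trans (ln_lipschitz _ _ _ _) _ => //.
  by rewrite opprD addrACA subrr add0r max0B_lipschitz.
move=> j r [p [q [d [rp rq rd d0 rE]]]].
(* At a rational argument the clamped value is a quotient of positive naturals: the truncated
   subtraction performs the clamping, and the logarithm becomes a difference of two logarithms of
   naturals. *)
apply: (CR_ext (fun v => ln (d v + (p v - q v - d v))%:R - ln (d v)%:R)); last first.
  by apply: CR_add; [|apply: CR_opp]; apply: CR_ln_nat; rec_auto.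
move=> v sv; have dp : 0 < (d v)%:R :> R by rewrite ltr0n lt0n.
rewrite -ln_div ?posrE//; last by rewrite ltr0n addn_gt0 lt0n d0.
congr ln; rewrite natrD mulrDl divff ?gt_eqF//; congr (1 + _).
rewrite rE// -[X in _ - X](divff (lt0r_neq0 dp)) -mulrBl.
case: (leqP (q v + d v) (p v)) => h.
  rewrite -subnDA natrB// natrD opprD addrA max_r// mulr_ge0 ?invr_ge0//.
  by rewrite -addrA -opprD subr_ge0 -natrD ler_nat.
have -> : (p v - q v - d v = 0)%N by lia.
rewrite mul0r max_l// mulr_le0_ge0 ?invr_ge0//.
by rewrite -addrA -opprD subr_le0 -natrD ler_nat ltnW.
Qed.

Lemma CR_real (x : R) : computable_real x -> CR 0 (fun=> x).
Proof.
move=> [r [/RQ_ratseq rr rE]]; exists (fun m _ => r m); split => // m v _.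
by rewrite distrC ltW.
Qed.

Lemma CR_cst {k} (x : R) : CR 0 (fun=> x) -> CR k (fun=> x).
Proof. by move=> cx; apply: (CR_subst _ (fun=> [::]) cx); exact: recsub_nil. Qed.

Lemma real_CR (x : R) : CR 0 (fun=> x) -> computable_real x.
Proof.
(* One extra digit of precision turns the weak bound of [CR] into the strict one of
   [computable_real]. *)
move=> [r [rr rE]]; exists (fun m => r m.+1 [::]); split.
  apply: (ratseq_RQ (fun v => r (head 0%N v).+1 (behead v))).
  by apply: (RQ_prec r (fun m _ => m.+1)) => //; rec_auto.
move=> n; rewrite distrC; apply: le_lt_trans (rE n.+1 [::] erefl) _.
by rewrite pow2NS ltr_pdivrMr// ltr_pMr ?pow2N_gt0// ltr1n.
Qed.

Lemma computable_realB (x y : R) : computable_real x -> computable_real y ->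
  computable_real (x - y).
Proof.
by move=> /CR_real cx /CR_real cy; apply/real_CR/CR_add => //; exact: CR_opp.
Qed.

Lemma computable_realN (x : R) : computable_real x -> computable_real (- x).
Proof. by move=> /CR_real cx; apply/real_CR/CR_opp. Qed.

End ComputableReals.

(** * Bumps and Riemann sums *)

Section Bumps.
Local Open Scope classical_set_scope.
Variable R : realType.
Implicit Types (A x y : R) (g h : R -> R).
Local Notation mu := (@lebesgue_measure R).

Lemma lipschitz_continuous (K : R) g : (forall x y, `|g x - g y| <= K * `|x - y|) ->
  continuous g.
Proof.
move=> lip x; apply/cvgrPdist_le => e e0.
have K0 : 0 < `|K| + 1 by rewrite ltr_wpDl.
near=> y; apply: (le_trans (lip _ _)).
apply: (@le_trans _ _ ((`|K| + 1) * `|x - y|)).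
  by rewrite ler_wpM2r// (le_trans (ler_norm _))// lerDl.
rewrite mulrC -ler_pdivlMr//; near: y.
by apply: cvgr_dist_le => //; rewrite divr_gt0.
Unshelve. all: by end_near. Qed.

(** The factor [6] normalises the parabola to mass [1] on an interval of width [1]. Being a positive
    part of a polynomial, it takes rational values at rational arguments. *)
Definition pbump A x : R := Num.max 0 (6 * (x - A) * (A + 1 - x)).

Lemma bump_ge0 A x : 0 <= pbump A x.
Proof. by rewrite /pbump le_max lexx. Qed.

Lemma bump_in A x : A <= x <= A + 1 -> pbump A x = 6 * (x - A) * (A + 1 - x).
Proof. by move=> /andP[? ?]; rewrite /pbump max_r// mulr_ge0 ?mulr_ge0; lra. Qed.

Lemma bump_out A x : ~~ (A <= x <= A + 1) -> pbump A x = 0.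
Proof.
rewrite negb_and -!ltNge => h; rewrite /pbump max_l//.
have : 0 <= (A - x) * (A + 1 - x).
  by case/orP: h => ?; [apply: mulr_ge0|apply: mulr_le0]; lra.
by rewrite -mulrA -(opprB A) mulNr; lra.
Qed.

Lemma bump_le2 A x : pbump A x <= 2.
Proof. by rewrite /pbump ge_max ler0n /=; have := sqr_ge0 (x - A - 2^-1); rewrite expr2; lra. Qed.

(** The slope of the parabola is at most [6] in absolute value on its interval, and the bump
    vanishes outside. By symmetry the one-sided inequality [H] is enough. *)
Lemma bump_lipschitz A x y : `|pbump A x - pbump A y| <= 6 * `|x - y|.
Proof.
suff H u v : pbump A u - pbump A v <= 6 * `|u - v|.
  by rewrite ler_norml H lerNl opprB distrC H.
have v0 := bump_ge0 A v.
have [uA|uA] := boolP (A <= u <= A + 1); last first.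
  by rewrite (bump_out _ _ uA); have := normr_ge0 (u - v); lra.
have [vA|vA] := boolP (A <= v <= A + 1).
  rewrite !bump_in//; move: uA vA => /andP[? ?] /andP[? ?].
  by case: (ler0P (u - v)) => ?; nra.
rewrite [X in _ - X]bump_out// bump_in//; move: uA vA => /andP[? ?].
by rewrite negb_and -!ltNge => /orP[] ?; case: (ler0P (u - v)) => ?; nra.
Qed.

Lemma bump_continuous A : continuous (pbump A).
Proof. exact: (lipschitz_continuous 6 (pbump A) (bump_lipschitz A)). Qed.

Lemma continuousM_bump A h : continuous h -> continuous (fun x => h x * pbump A x).
Proof. by move=> ch x; apply: continuousM; [exact: ch|exact: bump_continuous]. Qed.

Lemma continuous_integrable_itv g a b : continuous g ->
  mu.-integrable `[a, b] (EFin \o g).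
Proof.
move=> cg; apply: continuous_compact_integrable; first exact: segment_compact.
exact: continuous_subspaceT.
Qed.

Lemma bump_restrict A h :
  (fun x => h x * pbump A x) \_ `[A, A + 1] = (fun x => h x * pbump A x).
Proof.
apply/funext => x; rewrite /patch; case: ifPn => //.
by rewrite notin_setE /= in_itv /= => /negP/bump_out ->; rewrite mulr0.
Qed.

Lemma integrable_bump A h : continuous h ->
  mu.-integrable setT (EFin \o (fun x => h x * pbump A x)).
Proof.
move=> ch; rewrite -[X in EFin \o X]bump_restrict -restrict_EFin.
apply/integrable_restrict => //; rewrite setTI.
exact/continuous_integrable_itv/continuousM_bump.
Qed.

Lemma Rintegral_bump A h :
  \int[mu]_x (h x * pbump A x) = \int[mu]_(x in `[A, A + 1]) (h x * pbump A x).
Proof. by rewrite [RHS]Rintegral_mkcond bump_restrict. Qed.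

Lemma Rintegral_split g a b c : continuous g -> a <= b -> b <= c ->
  \int[mu]_(x in `[a, c]) g x =
  \int[mu]_(x in `[a, b]) g x + \int[mu]_(x in `[b, c]) g x.
Proof.
move=> cg ab bc; apply/eqP; rewrite addrC -subr_eq; apply/eqP.
rewrite Rintegral_itvB ?bnd_simp//; last exact: continuous_integrable_itv.
rewrite Rintegral_itv_obnd_cbnd//.
apply: (integrableS _ _ _ (continuous_integrable_itv g b c cg)) => //.
by apply: subset_itvr; rewrite bnd_simp.
Qed.

Lemma Rintegral_near_cst g a d (e : R) : continuous g -> 0 <= d ->
  (forall x, a <= x <= a + d -> `|g x - g a| <= e) ->
  `|\int[mu]_(x in `[a, a + d]) g x - g a * d| <= e * d.
Proof.
move=> cg d0 ge.
have md : fine (mu `[a, a + d]) = d.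
  rewrite lebesgue_measure_itv /= lte_fin; case: ltP => [_|] /=; first by lra.
  by move=> h; lra.
have cint (r : R) : \int[mu]_(x in `[a, a + d]) (cst r x) = r * d.
  by rewrite Rintegral_cst// md.
have iC (r : R) : mu.-integrable `[a, a + d] (EFin \o cst r).
  by apply: continuous_integrable_itv => x; exact: cvg_cst.
have ig := continuous_integrable_itv g a (a + d) cg.
have hx x : `[a, a + d] x -> g a - e <= g x <= g a + e.
  by rewrite /= in_itv /= => /ge; rewrite ler_norml => /andP[? ?]; apply/andP; split; lra.
have : \int[mu]_(x in `[a, a + d]) g x <= \int[mu]_(x in `[a, a + d]) (cst (g a + e) x).
  by apply: le_Rintegral => // x /hx /andP[].
have : \int[mu]_(x in `[a, a + d]) (cst (g a - e) x) <= \int[mu]_(x in `[a, a + d]) g x.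
  by apply: le_Rintegral => // x /hx /andP[].
rewrite !cint ler_norml; move: (Rintegral _ _ _) => I ? ?.
by apply/andP; split; lra.
Qed.

(** Left endpoints: with [d = 1 / N.+1], each cell contributes an error of at most [L * d * d], and
    there are [N.+1] cells. *)
Lemma riemann_sum g A (L : R) N : continuous g ->
  (forall x y, A <= x <= A + 1 -> A <= y <= A + 1 -> `|g x - g y| <= L * `|x - y|) ->
  `|\sum_(j < N.+1) g (A + j%:R / N.+1%:R) / N.+1%:R -
    \int[mu]_(x in `[A, A + 1]) g x| <= L / N.+1%:R.
Proof.
move=> cg lip; rewrite distrC; set d : R := N.+1%:R^-1.
have d0 : 0 < d by rewrite invr_gt0.
have Nd : N.+1%:R * d = 1 by rewrite /d divff. clearbody d.
suff H n : (n <= N.+1)%N -> `|\int[mu]_(x in `[A, A + n%:R * d]) g x -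
    \sum_(j < n) g (A + j%:R * d) * d| <= n%:R * (L * d * d).
  have := H N.+1 (leqnn _); rewrite Nd => /le_trans; apply.
  by rewrite [leLHS](_ : _ = N.+1%:R * d * (L * d)); [rewrite Nd mul1r|ring].
elim: n => [_|n IH nN].
  by rewrite big_ord0 mul0r addr0 set_itv1 Rintegral_set1 subrr normr0 mul0r.
have nd : n%:R * d + d <= 1.
  rewrite (_ : _ + d = n.+1%:R * d); last by rewrite -natr1 mulrDl mul1r.
  by rewrite -[leRHS]Nd ler_wpM2r ?(ltW d0)// ler_nat.
have nd0 : 0 <= n%:R * d by rewrite mulr_ge0// ltW.
rewrite big_ord_recr /=; have -> : n.+1%:R * d = n%:R * d + d by rewrite -natr1 mulrDl mul1r.
rewrite addrA (Rintegral_split g A (A + n%:R * d))//; [|lra|lra].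
rewrite -natr1 mulrDl mul1r.
set I1 := Rintegral _ _ _; set I2 := Rintegral _ _ _.
rewrite (_ : I1 + I2 - _ = (I1 - \sum_(j < n) g (A + j%:R * d) * d) +
  (I2 - g (A + n%:R * d) * d)); last by ring.
apply: (le_trans (ler_normD _ _)); apply: lerD; first exact: IH (ltnW nN).
apply: Rintegral_near_cst => //; first exact: ltW.
move=> x /andP[? ?]; apply: (le_trans (lip _ _ _ _)); try by apply/andP; split; lra.
rewrite ler_wpM2l//.
  (* That [L] is nonnegative follows from the Lipschitz bound between the two ends of the
     interval. *)
  have /(le_trans (normr_ge0 _)) : `|g (A + 1) - g A| <= L * `|A + 1 - A|.
    by apply: lip; apply/andP; split; lra.
  by rewrite (_ : A + 1 - A = 1) ?normr1 ?mulr1//; lra.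
by rewrite ger0_norm; lra.
Qed.

Lemma integral_bump1 A : \int[mu]_x pbump A x = 1.
Proof.
(* The antiderivative of the parabola that rises from [0] at [A] to [1] at [A + 1]. *)
pose F x : R := 3 * (x - A) ^+ 2 - 2 * (x - A) ^+ 3.
have dF x : is_derive x 1 F (6 * (x - A) * (A + 1 - x)).
  rewrite /F; apply: is_derive_eq.
  by rewrite /GRing.scale /=; ring.
have cF : continuous F.
  by move=> x; apply: differentiable_continuous; apply/derivable1_diffP; case: (dF x).
have := @continuous_FTC2 R (fun x => 6 * (x - A) * (A + 1 - x)) F A (A + 1).
rewrite ltrDl ltr01 => /(_ isT) FTC.
have e : \int[mu]_x pbump A x = \int[mu]_(x in `[A, A + 1]) (6 * (x - A) * (A + 1 - x)).
  rewrite -(@eq_Rintegral _ _ _ mu setT _ (fun x => cst 1 x * pbump A x)); last first.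
    by move=> x _; rewrite /= mul1r.
  rewrite Rintegral_bump; apply: eq_Rintegral => x.
  by rewrite inE /= in_itv /= mul1r => /bump_in.
rewrite e /Rintegral FTC /=.
- by rewrite /F; ring.
- apply: continuous_subspaceT => x.
  by apply: cvgM; [apply: cvgMr; apply: cvgB => //; exact: cvg_cst|
    apply: cvgB => //; exact: cvg_cst].
- split.
  + by move=> x _; case: (dF x).
  + exact/cvg_at_right_filter/cF.
  + exact/cvg_at_left_filter/cF.
- by move=> x _; rewrite derive1E; case: (dF x).
Qed.

End Bumps.

(** * Mixtures of bumps *)

Section Density.
Local Open Scope classical_set_scope.
Variable R : realType.
Implicit Types (A x y C : R) (f g h G : R -> R) (u v : nat -> R).
Local Notation mu := (@lebesgue_measure R).

(** * Series with geometric bounds *)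

Lemma cvg_pow2N C : C * 2 ^- n @[n --> \oo] --> (0 : R).
Proof.
have h : `|2^-1 : R| < 1 by rewrite ger0_norm ?invr_ge0// invf_lt1// ltr1n.
rewrite -(mulr0 C); apply: cvgMr.
by under eq_fun do rewrite -exprVn; apply: cvg_expr.
Qed.

Lemma cvg_geom v C l : (forall n, `|v n - l| <= C * 2 ^- n) -> v n @[n --> \oo] --> l.
Proof.
move=> vl; apply/cvgrPdist_le => e e0; near=> n.
rewrite distrC (le_trans (vl n))// (le_trans (ler_norm _))//.
near: n; have /cvgrPdist_le/(_ _ e0) := cvg_pow2N C.
by under eq_near do rewrite sub0r normrN.
Unshelve. all: by end_near. Qed.

Lemma le_geom C a b : (forall n, a <= b + C * 2 ^- n) -> a <= b.
Proof.
move=> h; have c : b + C * 2 ^- n @[n --> \oo] --> b.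
  by rewrite -[X in _ --> X]addr0; apply: cvgD; [exact: cvg_cst|exact: cvg_pow2N].
by apply: (cvgr_to_ge c); exact: nearW.
Qed.

Lemma sum_pow2N n : \sum_(i < n) 2 ^- i.+1 = 1 - 2 ^- n :> R.
Proof.
elim: n => [|n IH]; first by rewrite big_ord0 expr0 invr1 subrr.
by rewrite big_ord_recr /= IH pow2NS; lra.
Qed.

(** Partial sums increase, and a block starting at [n] adds at most [C * 2 ^- n]; monotone
    convergence supplies the limit and the bound passes to it. *)
Lemma geom_series_ge0 u C : (forall i, 0 <= u i <= C * 2 ^- i.+1) ->
  forall n, 0 <= limn (fun n => \sum_(i < n) u i) - \sum_(i < n) u i <= C * 2 ^- n.
Proof.
move=> uC; pose s n := \sum_(i < n) u i.
have sS n : s n.+1 = s n + u n by rewrite /s big_ord_recr.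
have s_diff n m : s n <= s (n + m)%N <= s n + C * (2 ^- n - 2 ^- (n + m)%N).
  elim: m => [|m /andP[h1 h2]]; first by rewrite addn0 subrr mulr0 addr0 lexx.
  have := uC (n + m)%N; rewrite addnS sS pow2NS; move: (2 ^- (n + m)) h2 => e h2.
  by move=> /andP[? ?]; apply/andP; split; lra.
have C0 : 0 <= C.
  by have /andP[/le_trans h /h] := uC 0%N; rewrite pmulr_lge0// pow2N_gt0.
have nd : nondecreasing_seq s.
  by move=> n m nm; rewrite -(subnKC nm); have /andP[] := s_diff n (m - n)%N.
have sC n m : (n <= m)%N -> s m <= s n + C * 2 ^- n.
  move=> nm; rewrite -(subnKC nm); have /andP[_ /le_trans] := s_diff n (m - n)%N; apply.
  by rewrite lerD2l ler_wpM2l// lerBlDr lerDl pow2N_ge0.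
have cs : cvgn s.
  apply: nondecreasing_is_cvgn => //; exists (s 0%N + C * 2 ^- 0%N) => _ [n _ <-].
  exact: sC.
move=> n; rewrite -/(s n) subr_ge0 lerBlDr addrC; apply/andP; split.
  exact: nondecreasing_cvgn_le.
by apply: limr_le => //; near=> m; apply: sC; near: m; exact: nbhs_infty_ge.
Unshelve. all: by end_near. Qed.

(** Adding [C * 2 ^- i.+1] to each term reduces to the nonnegative case with constant [2 * C]; the
    added series has sum [C]. *)
Lemma geom_series u C : (forall i, `|u i| <= C * 2 ^- i.+1) ->
  forall n, `|\sum_(i < n) u i - limn (fun n => \sum_(i < n) u i)| <= C * 2 ^- n.
Proof.
move=> uC; pose u' i := u i + C * 2 ^- i.+1.
have u'C i : 0 <= u' i <= 2 * C * 2 ^- i.+1.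
  by have := uC i; rewrite /u' ler_norml => /andP[? ?]; apply/andP; split; lra.
have sE n : \sum_(i < n) u' i = \sum_(i < n) u i + C * (1 - 2 ^- n).
  by rewrite big_split /= -mulr_sumr sum_pow2N.
have h := geom_series_ge0 _ _ u'C; set T := limn _ in h.
suff -> : limn (fun n => \sum_(i < n) u i) = T - C.
  by move=> n; have := h n; rewrite sE ler_norml => /andP[? ?]; apply/andP; split; lra.
apply: cvg_lim => //; apply: (cvg_geom _ C) => n.
by have := h n; rewrite sE ler_norml => /andP[? ?]; apply/andP; split; lra.
Qed.

Lemma continuous_measurable_EFin g : continuous g ->
  @measurable_fun _ _ (measurableTypeR R) _ setT (EFin \o g).
Proof.
move=> /(continuous_measurable_fun (f:=g)) mg.
exact: ((measurable_EFinP (T:=measurableTypeR R) setT g).2 mg).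
Qed.

(** Integrability is carried along with the value, because additivity of the integral depends on
    it. *)
Definition integral_is g (a : R) :=
  mu.-integrable setT (EFin \o g) /\ (\int[mu]_x (g x)%:E)%E = a%:E.

Lemma integral_isD f g a b : integral_is f a -> integral_is g b ->
  integral_is (fun x => f x + g x) (a + b).
Proof.
move=> [fi fa] [gi gb]; split.
  exact: (integrableD measurableT fi gi).
by rewrite integralD_EFin// fa gb.
Qed.

Lemma integral_isZ f a c : integral_is f a -> integral_is (fun x => c * f x) (c * a).
Proof.
move=> [fi fa]; split; first exact: (integrableZl measurableT c fi).
by under eq_integral do rewrite EFinM; rewrite (integralZl measurableT fi) fa.
Qed.

Lemma integral_is_ext f g a : f =1 g -> integral_is f a -> integral_is g a.
Proof. by move=> /funext ->. Qed.

Lemma integral_is_bump A h : continuous h ->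
  integral_is (fun x => h x * pbump R A x) (\int[mu]_x (h x * pbump R A x)).
Proof.
move=> ch; have ib := integrable_bump R A h ch; split => //.
by rewrite /Rintegral fineK//; exact: integrable_fin_num.
Qed.

Lemma integral_is_sum (fs : nat -> R -> R) (a : nat -> R) n :
  (forall i, integral_is (fs i) (a i)) ->
  integral_is (fun x => \sum_(i < n) fs i x) (\sum_(i < n) a i).
Proof.
move=> H; elim: n => [|n IH].
  apply: (@integral_is_ext (fun=> 0)); first by move=> x; rewrite big_ord0.
  by rewrite big_ord0; split; [exact: integrable0|exact: integral0].
rewrite big_ord_recr /=; apply: integral_is_ext (integral_isD _ _ _ _ IH (H n)).
by move=> x; rewrite big_ord_recr.
Qed.

(** * The density and its approximations *)

Variables (a w : nat -> R).
Hypothesis w_ge0 : forall i, 0 <= w i.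
Hypothesis w_le : forall i, w i <= 2 ^- i.+1.

Definition mixpart n x : R := \sum_(i < n) w i * pbump R (a i) x.
Definition mixsum x : R := limn (fun n => mixpart n x).
Definition mass : R := limn (fun n => \sum_(i < n) w i).
Definition density x : R := (1 - mass) * pbump R 1 x + mixsum x.
(** The first [n] masses are moved from the bump at [1] to their places, so every approximant has
    integral [1]. The limit [mass] does not enter, hence values at rational points are rational when
    [a] and [w] are. *)
Definition density_approx n x : R :=
  pbump R 1 x + \sum_(i < n) w i * (pbump R (a i) x - pbump R 1 x).

Lemma massP n : 0 <= mass - \sum_(i < n) w i <= 2 ^- n.
Proof.
have := geom_series_ge0 w 1 _ n; rewrite mul1r; apply => i.
by rewrite w_ge0 mul1r w_le.
Qed.

Lemma mass_le1 : mass <= 1.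
Proof. by have := massP 0; rewrite big_ord0 subr0 expr0 invr1 => /andP[]. Qed.

Lemma mixsumP x n : 0 <= mixsum x - mixpart n x <= 2 * 2 ^- n.
Proof.
apply: (geom_series_ge0 (fun i => w i * pbump R (a i) x)) => i.
rewrite mulr_ge0 ?w_ge0 ?bump_ge0//= mulrC ler_pM ?bump_ge0 ?w_ge0 ?w_le//.
exact: bump_le2.
Qed.

Lemma density_ge0 x : 0 <= density x.
Proof.
have := mixsumP x 0; rewrite /mixpart big_ord0 subr0 => /andP[h _].
by rewrite addr_ge0// mulr_ge0 ?bump_ge0// subr_ge0 mass_le1.
Qed.

Lemma approxE n x : density_approx n x = (1 - \sum_(i < n) w i) * pbump R 1 x + mixpart n x.
Proof.
rewrite /density_approx /mixpart mulrBl mul1r -addrA; congr (_ + _).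
under eq_bigr do rewrite mulrBr.
by rewrite sumrB -mulr_suml addrC.
Qed.

Lemma approx_density n x : `|density_approx n x - density x| <= 2 * 2 ^- n.
Proof.
rewrite approxE /density; have := mixsumP x n; have := massP n.
have := bump_ge0 R 1 x; have := bump_le2 R 1 x.
move: (pbump R 1 x) (mixsum x) (mixpart n x) (\sum_(i < n) w i) (2 ^- n) => B S Sn Wn e.
move=> ? ? /andP[? ?] /andP[? ?]; rewrite ler_norml; apply/andP; split; nra.
Qed.

Lemma sum_w_le1 n : \sum_(i < n) w i <= 1.
Proof. by have := massP n; have := mass_le1 => ? /andP[? ?]; lra. Qed.

(** The bump at [1] contributes [6]; each difference of bumps has constant [12], and the weights sum
    to at most [1]. The bound depends neither on [n] nor on the positions [a i]. *)
Lemma approx_lipschitz n x y : `|density_approx n x - density_approx n y| <= 18 * `|x - y|.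
Proof.
rewrite /density_approx opprD addrACA -sumrB.
rewrite (_ : 18 * _ = 6 * `|x - y| + 12 * `|x - y|); last by ring.
apply: (le_trans (ler_normD _ _)); apply: lerD; first exact: bump_lipschitz.
apply: (le_trans (ler_norm_sum _ _ _)).
apply: (@le_trans _ _ (\sum_(i < n) w i * (12 * `|x - y|))).
  apply: ler_sum => i _; rewrite -mulrBr normrM ger0_norm ?w_ge0// ler_wpM2l ?w_ge0//.
  rewrite opprD addrACA -opprD (le_trans (ler_normB _ _))//.
  by have := bump_lipschitz R (a i) x y; have := bump_lipschitz R 1 x y; lra.
by rewrite -mulr_suml ler_piMl ?sum_w_le1// mulr_ge0.
Qed.

Lemma density_lipschitz x y : `|density x - density y| <= 18 * `|x - y|.
Proof.
apply: (le_geom 4) => n; have := approx_lipschitz n x y.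
have := approx_density n x; have := approx_density n y.
move: (density_approx n x) (density_approx n y) (density x) (density y) (`|x - y|) => p q f g d.
by rewrite !ler_norml => /andP[? ?] /andP[? ?] /andP[? ?]; apply/andP; split; lra.
Qed.

Lemma density_continuous : continuous density.
Proof. exact: (lipschitz_continuous R 18 _ density_lipschitz). Qed.

Lemma approx_continuous n : continuous (density_approx n).
Proof. exact: (lipschitz_continuous R 18 _ (approx_lipschitz n)). Qed.

(** Monotone convergence. Unlike [density_approx], the functions [g n] keep the coefficient
    [1 - mass] of the bump at [1] fixed, which makes them nondecreasing in [n]. *)
Lemma integral_density G T : continuous G -> (forall x, 0 <= G x) ->
  \sum_(i < n) w i * (\int[mu]_x (G x * pbump R (a i) x)) @[n --> \oo] --> T ->
  integral_is (fun x => G x * density x)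
    ((1 - mass) * (\int[mu]_x (G x * pbump R 1 x)) + T).
Proof.
move=> cG G0 cT; pose g n x := G x * ((1 - mass) * pbump R 1 x + mixpart n x).
have ig n : integral_is (g n) ((1 - mass) * (\int[mu]_x (G x * pbump R 1 x)) +
    \sum_(i < n) w i * (\int[mu]_x (G x * pbump R (a i) x))).
  apply: (@integral_is_ext (fun x => (1 - mass) * (G x * pbump R 1 x) +
     \sum_(i < n) w i * (G x * pbump R (a i) x))).
    move=> x; rewrite /g mulrDr mulrCA; congr (_ + _); rewrite mulr_sumr.
    by apply: eq_bigr => i _; rewrite mulrCA.
  apply: integral_isD; first exact/integral_isZ/integral_is_bump.
  apply: (integral_is_sum (fun i x => w i * (G x * pbump R (a i) x))
    (fun i => w i * (\int[mu]_x (G x * pbump R (a i) x))) n) => i.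
  exact/integral_isZ/integral_is_bump.
have cg x : (g n x)%:E @[n --> \oo] --> (G x * density x)%:E.
  apply/cvg_EFin; first exact: nearW.
  apply: cvgMr; apply: cvgD; first exact: cvg_cst.
  apply: (cvg_geom _ 2) => n; have /andP[h1 h2] := mixsumP x n.
  by rewrite distrC ger0_norm.
have nd x : nondecreasing_seq (fun n => (g n x)%:E).
  apply/nondecreasing_seqP => n; rewrite lee_fin /g ler_wpM2l// lerD2l.
  by rewrite /mixpart big_ord_recr /= lerDl mulr_ge0 ?bump_ge0.
have gf x : limn (fun n => (g n x)%:E) = (G x * density x)%:E by apply: cvg_lim.
have mg n := measurable_int mu (ig n).1.
have g0 n x : (0 <= (g n x)%:E)%E.
  rewrite lee_fin mulr_ge0// addr_ge0 ?mulr_ge0 ?bump_ge0//.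
    by rewrite subr_ge0 mass_le1.
  by apply: sumr_ge0 => i _; rewrite mulr_ge0 ?bump_ge0.
have := @cvg_monotone_convergence _ _ _ mu setT measurableT _ mg
   (fun n x _ => g0 n x) (fun x _ => nd x).
under eq_fun do rewrite (ig _).2.
under eq_integral do rewrite gf.
set I := (\int[mu]_x _)%E => cI.
have IE : I = ((1 - mass) * (\int[mu]_x (G x * pbump R 1 x)) + T)%:E.
  apply: (cvg_unique _ cI) => //; apply/cvg_EFin; first exact: nearW.
  by apply: cvgD => //; exact: cvg_cst.
split => //; apply/integrableP; split.
  apply: continuous_measurable_EFin => x.
  by apply: continuousM; [exact: cG|exact: density_continuous].
under eq_integral do rewrite /= ger0_norm ?mulr_ge0 ?density_ge0//.
by rewrite -/I IE ltry.
Qed.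

Lemma Rintegral_1bump A : \int[mu]_x ((fun=> 1) x * pbump R A x) = 1.
Proof. by under eq_Rintegral do rewrite mul1r; exact: integral_bump1. Qed.

Lemma integral_is_bump1 A : integral_is (pbump R A) 1.
Proof.
rewrite -(Rintegral_1bump A).
apply: integral_is_ext (integral_is_bump A (fun=> 1) _) => [x|x]; first by rewrite mul1r.
exact: cvg_cst.
Qed.

Lemma integral_density1 : integral_is density 1.
Proof.
have -> : 1 = (1 - mass) * (\int[mu]_x ((fun=> 1) x * pbump R 1 x)) + mass.
  by rewrite Rintegral_1bump; ring.
apply: integral_is_ext (integral_density (fun=> 1) mass _ _ _) => //.
- by move=> x; rewrite mul1r.
- by move=> x; exact: cvg_cst.
- under eq_fun do under eq_bigr do rewrite Rintegral_1bump mulr1.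
  apply: (cvg_geom _ 1) => n; have /andP[h1 h2] := massP n.
  by rewrite distrC ger0_norm// mul1r.
Qed.

Lemma integral_approx1 n : integral_is (density_approx n) 1.
Proof.
have -> : 1 = (1 - \sum_(i < n) w i) * 1 + \sum_(i < n) w i * 1 :> R.
  by rewrite -mulr_suml; ring.
apply: (integral_is_ext _ _ _ (fun x => esym (approxE n x))).
apply: integral_isD; first exact/integral_isZ/integral_is_bump1.
apply: (integral_is_sum (fun i x => w i * pbump R (a i) x) (fun i => w i * 1) n) => i.
exact/integral_isZ/integral_is_bump1.
Qed.

Lemma density_pdf : cont_pdf density.
Proof.
split; [exact: density_continuous|exact: density_ge0|
  exact: (continuous_measurable_fun density_continuous)|exact: integral_density1.2].
Qed.

Lemma density_L1 : L1 density.
Proof.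
split; first exact: (continuous_measurable_fun density_continuous).
exact: integral_density1.1.
Qed.

Lemma approx_L1 n : L1 (density_approx n).
Proof.
split; first exact: (continuous_measurable_fun (approx_continuous n)).
exact: (integral_approx1 n).1.
Qed.

(** With [delta] the mass missing after [n] terms, the difference is a nonnegative tail minus
    [delta] times the bump at [1]. Its absolute value is therefore at most the difference itself
    plus [2 * delta] times that bump, and the integral of this majorant is [2 * delta]. *)
Lemma dist_approx n : (\int[mu]_x (`|density x - density_approx n x|)%:E <= (2 * 2 ^- n)%:E)%E.
Proof.
set c := 2 * (mass - \sum_(i < n) w i).
have c0 : 0 <= c by have /andP[? _] := massP n; rewrite mulr_ge0.
have ig : integral_is (fun x => (density x + -1 * density_approx n x) + c * pbump R 1 x)
    ((1 + -1 * 1) + c * 1).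
  apply: integral_isD; last exact/integral_isZ/integral_is_bump1.
  apply: integral_isD; first exact: integral_density1.
  exact/integral_isZ/integral_approx1.
apply: (@le_trans _ _ c%:E); last first.
  by rewrite lee_fin /c ler_wpM2l//; have /andP[] := massP n.
rewrite (_ : c%:E = (1 + -1 * 1 + c * 1)%:E); last by congr EFin; ring.
rewrite -ig.2; apply: ge0_le_integral => //=.
- apply: (continuous_measurable_EFin (fun x => `|density x - density_approx n x|)) => x.
  by apply: cvg_norm; apply: cvgB; [exact: density_continuous|exact: approx_continuous].
- by have [/measurable_int] := ig.
- move=> x _; rewrite lee_fin approxE /density /c; have := bump_ge0 R 1 x.
  have /andP[] := mixsumP x n; have /andP[] := massP n.
  move: (pbump R 1 x) (mixsum x) (mixpart n x) (\sum_(i < n) w i) => B S Sn Wn.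
  by move=> ? ? ? ? ?; rewrite ler_norml; apply/andP; split; nra.
Qed.

End Density.

(** * The capacity integral *)

Section Computing.
Local Open Scope classical_set_scope.
Variable R : realType.
Implicit Types (A x y C c : R) (k n m : nat) (r : seq nat -> R).
Local Notation mu := (@lebesgue_measure R).
Local Notation RQ := (RQ R).
Local Notation CR := (CR R).

Lemma RQ_cst {k} n : RQ k (fun=> n%:R).
Proof. by apply: RQ_nat; exact: rec_cst. Qed.

Lemma RQ_pbump {k} (A r : seq nat -> R) : RQ k A -> RQ k r ->
  RQ k (fun v => pbump R (A v) (r v)).
Proof.
move=> rA rr; have rNr := RQ_opp _ _ rr; have rNA := RQ_opp _ _ rA.
apply: RQ_max0; apply: RQ_mul; first apply: RQ_mul.
- exact: (RQ_cst 6).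
- exact: RQ_add.
- by apply: RQ_add => //; apply: RQ_add => //; exact: (RQ_cst 1).
Qed.

Section ApproxComputable.
Variables (a w : nat -> R).
Hypothesis a_RQ : RQ 1 (fun v => a (head 0%N v)).
Hypothesis w_RQ : RQ 1 (fun v => w (head 0%N v)).
Hypothesis w_ge0 : forall i, 0 <= w i.
Hypothesis w_le : forall i, w i <= 2 ^- i.+1.

Lemma RQ_head1 {k} (b : nat -> R) : RQ 1 (fun v => b (head 0%N v)) ->
  RQ k.+1 (fun v => b (head 0%N v)).
Proof.
move=> rb; apply: (RQ_subst _ _ (fun v => [:: head 0%N v]) rb).
by apply: recsub_cons; [exact: rec_head|exact: recsub_nil].
Qed.

Lemma RQ_approx {k} (f : seq nat -> nat) r : rec k f -> RQ k r ->
  RQ k (fun v => density_approx R a w (f v) (r v)).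
Proof.
move=> rf rr; have r1 j (s : seq nat -> R) : RQ j s -> RQ j (fun v => pbump R 1 (s v)).
  by move=> rs; apply: RQ_pbump => //; exact: (RQ_cst 1).
apply: RQ_add; first exact: r1.
apply: (RQ_sum _ (fun i v => w i * (pbump R (a i) (r v) - pbump R 1 (r v)))) => //.
have rr' : RQ k.+1 (fun w => r (behead w)) by exact: RQ_weak.
apply: RQ_mul; first exact: RQ_head1.
apply: RQ_add; first by apply: RQ_pbump => //; exact: RQ_head1.
by apply: RQ_opp; exact: r1.
Qed.

Lemma approx_funseq : computable_funseq (density_approx R a w).
Proof.
have lip := approx_lipschitz R a w w_ge0 w_le.
split.
  move=> xs [r [/RQ_ratseq2 rr rE]].
  (* Precision is raised by [18] to absorb the Lipschitz constant [18]. *)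
  pose rho v := density_approx R a w (head 0%N (behead v))
     (r (head 0%N v + 18)%N (head 0%N (behead (behead v)))).
  exists (fun m n l => rho [:: m; n; l]); split.
    apply: ratseq3_RQ; apply: RQ_approx; first exact/rec_weak/rec_head.
    apply: (RQ_subst _ _ (fun v => [:: head 0%N v + 18; head 0%N (behead (behead v))])%N rr).
    apply: recsub_cons; first by apply: rec_add; [exact: rec_head|exact: rec_cst].
    apply: recsub_cons; last exact: recsub_nil.
    exact/(rec_weak (fun v => head 0%N (behead v)))/rec_weak/rec_head.
  move=> m n l; rewrite /rho /=; apply: le_trans (lip _ _ _) _.
  by apply: le_trans (pow2N_mul R m 18); rewrite ler_wpM2l.
(* The Lipschitz bound is global and uniform, so the modulus ignores both the index and the
   interval. *)
exists (fun _ _ N => 18 * 2 ^ N)%N; split.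
  have [c cP] : rec 3 (fun v => 18 * 2 ^ head 0 (behead (behead v)))%N.
    apply: rec_mul; first exact: rec_cst.
    apply: rec_exp; first exact: rec_cst.
    exact/(rec_weak (fun v => head 0%N (behead v)))/rec_weak/rec_head.
  by exists c => m n l; apply: cP.
move=> n M N; split; first by rewrite muln_gt0 expn_gt0.
move=> x y _ _ xy; apply: le_trans (lip _ _ _) _.
apply: (@le_trans _ _ (18 * (18 * 2 ^ N)%:R^-1)); first by rewrite ler_wpM2l.
by rewrite natrM natrX invfM mulrA divff ?mul1r.
Qed.

Lemma density_computable : computable_L1 (density R a w).
Proof.
split; first exact: density_L1.
exists (density_approx R a w); split; [exact: approx_funseq|by move=> n; exact: approx_L1|].
(* The distance is at most [2 * 2 ^- n], whence the shift by one. *)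
exists succn; split.
  have [c cP] : rec 1 (fun v => (head 0%N v).+1) by apply/rec_S/rec_head.
  by exists c => n; apply: cP.
move=> M n Mn; apply: le_trans (dist_approx R a w w_ge0 w_le n) _.
rewrite lee_fin -(subnKC Mn) exprD exprS !invfM !mulrA divff// mul1r.
by rewrite ler_piMr ?invr_ge0 ?exprn_ge0// invf_le1 ?exprn_gt0// exprn_ege1// ler1n.
Qed.

End ApproxComputable.

(** * The logarithm averaged over a bump *)

Section LogIntegral.
Variables (P s : R).
Hypotheses (P_comp : computable_real P) (s_comp : computable_real s).
Hypotheses (P_gt0 : 0 < P) (s_gt0 : 0 < s).

Definition snr x : R := log2 (1 + P * x ^+ 2 / s).

Lemma snr_arg_ge1 x : 1 <= 1 + P * x ^+ 2 / s.
Proof.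
  rewrite lerDl; apply: divr_ge0; last exact: ltW.
  by apply: mulr_ge0; [exact: ltW|exact: sqr_ge0].
Qed.

Lemma ln2_ge : 2^-1 <= ln 2 :> R.
Proof.
have := ln_le_subr1 R (2^-1) (ltac:(by rewrite invr_gt0)).
by rewrite lnV ?posrE//; lra.
Qed.

Lemma ln2_gt0 : 0 < ln 2 :> R.
Proof. by have := ln2_ge; lra. Qed.

Lemma snr_ge0 x : 0 <= snr x.
Proof. by rewrite /snr /log2 divr_ge0 ?(ltW ln2_gt0)// ln_ge0// snr_arg_ge1. Qed.

Lemma snr_continuous : continuous snr.
Proof.
move=> x; apply: cvgMl; apply: (@continuous_comp _ _ _ (fun x => 1 + P * x ^+ 2 / s) (@ln R)).
  apply: cvgD; first exact: cvg_cst.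
  by apply: cvgMl; apply: cvgMr; exact: exprn_continuous.
by apply: continuous_ln; rewrite (lt_le_trans _ (snr_arg_ge1 _)).
Qed.

Lemma CR_snr {k} r : RQ k r -> CR k (fun v => snr (r v)).
Proof.
move=> rr; have cr := CR_RQ _ _ rr.
have cP := CR_cst (k:=k) _ _ (CR_real _ _ P_comp).
have cs := CR_cst (k:=k) _ _ (CR_real _ _ s_comp).
apply: CR_mul; last first.
  apply: (CR_inv _ 1); first by move=> v _; exact: ln2_ge.
  exact: (CR_ln_nat R (fun=> 2%N) (rec_cst _)).
apply: CR_ln; first by move=> v _; exact: snr_arg_ge1.
apply: CR_add; first exact/CR_RQ/(RQ_cst 1).
apply: CR_mul.
  by apply: CR_mul => //; exact: CR_mul.
(* [D] is a fixed natural number, so it may occur in a code however it was obtained. *)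
have [D Ds] : exists D, D.+1%:R^-1 <= s.
  exists (Num.truncn s^-1); rewrite invf_ple ?posrE// ltW//.
  exact: truncnS_gt.
exact: (CR_inv _ D).
Qed.

Lemma snrE x : snr x = ln (1 + P / s * x ^+ 2) / ln 2.
Proof. by rewrite /snr /log2 (mulrAC P). Qed.

(** For [1 <= y <= x <= y + 1] one has [x + y <= 3 * y] and [y <= y ^+ 2], so with [c = P / s] the
    quotient [c * (x + y) / (1 + c * y ^+ 2)] is at most [3]; dividing by [ln 2 >= 1 / 2] doubles
    this. The constant is independent of [P] and [s]. *)
Lemma snr_lipschitz x y : 1 <= x -> 1 <= y -> `|x - y| <= 1 ->
  `|snr x - snr y| <= 6 * `|x - y|.
Proof.
wlog xy : x y / y <= x => [H|] x1 y1 d1.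
  by case: (leP y x) => h; [exact: H|rewrite distrC [in leRHS]distrC H 1?distrC// ltW].
move: d1; rewrite [`|x - y|]ger0_norm ?subr_ge0// => d1.
have c0 : 0 < P / s by rewrite divr_gt0.
rewrite !snrE -mulrBl normrM [`|(ln 2)^-1|]ger0_norm ?invr_ge0 ?(ltW ln2_gt0)//.
rewrite ler_pdivrMr ?ln2_gt0//.
apply: (@le_trans _ _ (3 * (x - y))); last first.
  have : (x - y) * 2^-1 <= (x - y) * ln 2 by rewrite ler_wpM2l ?ln2_ge ?subr_ge0.
  lra.
set c := P / s in c0 *.
have p z : 0 < 1 + c * z ^+ 2 by have := sqr_ge0 z; nra.
rewrite ger0_norm; last first.
  rewrite subr_ge0 ler_ln ?posrE// lerD2l ler_wpM2l ?(ltW c0)//.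
  by rewrite ler_pXn2r ?nnegrE//; lra.
apply: (le_trans (ln_sub_bound _ _ _ (p x) (p y))).
rewrite ler_pdivrMr//.
rewrite (_ : 1 + c * x ^+ 2 - _ = (x - y) * (c * (x + y))); last by ring.
rewrite [leRHS](_ : _ = (x - y) * (3 * (1 + c * y ^+ 2))); last by ring.
apply: ler_wpM2l; first by rewrite subr_ge0.
have : c * (x + y) <= c * (3 * y) by rewrite ler_wpM2l ?(ltW c0)//; lra.
have : c * y <= c * y ^+ 2 by rewrite ler_wpM2l ?(ltW c0)// expr2 ler_peMr//; lra.
lra.
Qed.

(** With [A = 2 ^+ k], the number [2 * k] is the binary logarithm of [A ^+ 2]. As [A <= x <= 2 * A],
    the quotient of the two arguments lies between [P / s] and [1 + 4 * (P / s)], whatever [k]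
    is. *)
Lemma snr_near_2k : exists C, forall k x, 2 ^+ k <= x <= 2 ^+ k + 1 ->
  `|snr x - (2 * k)%:R| <= C.
Proof.
have c0 : 0 < P / s by rewrite divr_gt0.
exists ((`|ln (P / s)| + `|ln (1 + 4 * (P / s))|) / ln 2) => k x /andP[x1 x2].
have A1 : 1 <= 2 ^+ k :> R by rewrite exprn_ege1// ler1n.
rewrite snrE; set c := P / s in c0 *; set A : R := 2 ^+ k in x1 x2 A1 *.
have -> : (2 * k)%:R = ln (A ^+ 2) / ln 2.
  by rewrite /A -exprM lnXn// (mulnC k) -[X in X / _]mulr_natl mulfK// gt_eqF// ln2_gt0.
rewrite -mulrBl normrM [`|(ln 2)^-1|]ger0_norm ?invr_ge0 ?(ltW ln2_gt0)//.
rewrite ler_wpM2r ?invr_ge0 ?(ltW ln2_gt0)//.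
have A2 : 0 < A ^+ 2 by rewrite exprn_gt0//; lra.
have p : 0 < 1 + c * x ^+ 2 by have := sqr_ge0 x; nra.
rewrite -ln_div ?posrE//.
have xA : A ^+ 2 <= x ^+ 2 by rewrite ler_pXn2r ?nnegrE//; lra.
have xA4 : x ^+ 2 <= 4 * A ^+ 2.
  by rewrite (_ : 4 * A ^+ 2 = (2 * A) ^+ 2); [rewrite ler_pXn2r ?nnegrE//; lra|ring].
have lo : c <= (1 + c * x ^+ 2) / A ^+ 2.
  rewrite ler_pdivlMr//; have : c * A ^+ 2 <= c * x ^+ 2 by rewrite ler_wpM2l// ltW.
  lra.
have hi : (1 + c * x ^+ 2) / A ^+ 2 <= 1 + 4 * c.
  rewrite ler_pdivrMr//; have : c * x ^+ 2 <= c * (4 * A ^+ 2) by rewrite ler_wpM2l// ltW.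
  have : 1 <= A ^+ 2 by rewrite exprn_ege1.
  lra.
have q : 0 < (1 + c * x ^+ 2) / A ^+ 2 by rewrite divr_gt0.
have l1 : ln c <= ln ((1 + c * x ^+ 2) / A ^+ 2) by rewrite ler_ln ?posrE.
have l2 : ln ((1 + c * x ^+ 2) / A ^+ 2) <= ln (1 + 4 * c) by rewrite ler_ln ?posrE//; lra.
rewrite ler_norml; have := ler_norm (ln (1 + 4 * c)); have := ler_norm (- ln c).
rewrite normrN; have := normr_ge0 (ln c); have := normr_ge0 (ln (1 + 4 * c)).
by move=> ? ? ? ?; apply/andP; split; lra.
Qed.

Definition excess k : R :=
  \int[mu]_x (snr x * pbump R (2 ^+ k) x) - (2 * k)%:R.

Let g k x := (snr x - (2 * k)%:R) * pbump R (2 ^+ k) x.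

Let g_continuous k : continuous (fun x => snr x - (2 * k)%:R).
Proof. by move=> x; apply: cvgB; [exact: snr_continuous|exact: cvg_cst]. Qed.

Lemma excessE k : excess k = \int[mu]_(x in `[2 ^+ k, 2 ^+ k + 1]) g k x.
Proof.
rewrite -Rintegral_bump.
have [_ h1] := integral_is_bump R (2 ^+ k) _ (g_continuous k).
have [_ h2] := integral_isD _ _ _ _ _ (integral_is_bump R (2 ^+ k) _ snr_continuous)
  (integral_isZ _ _ _ (- (2 * k)%:R) (integral_is_bump1 R (2 ^+ k))).
rewrite mulr1 in h2; apply: EFin_inj; rewrite -h1 -h2.
by apply: eq_integral => x _; congr EFin; ring.
Qed.

(** Product rule: the centred logarithm is bounded by [C] and has constant [6], the bump is bounded
    by [2] and has constant [6], which gives [6 * C + 12]. Centring at [2 * k] is what makes this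
    uniform in [k]. *)
Lemma g_lipschitz : exists L : nat, forall k x y,
  2 ^+ k <= x <= 2 ^+ k + 1 -> 2 ^+ k <= y <= 2 ^+ k + 1 ->
  `|g k x - g k y| <= L%:R * `|x - y|.
Proof.
have [C hC] := snr_near_2k; exists (Num.truncn (6 * C + 12)).+1 => k x y hx hy.
apply: (@le_trans _ _ ((6 * C + 12) * `|x - y|)); last first.
  by rewrite ler_wpM2r// ltW// truncnS_gt.
have A1 : 1 <= 2 ^+ k :> R by rewrite exprn_ege1// ler1n.
have Cx := hC k x hx; have b2 := bump_le2 R (2 ^+ k) y.
have lg : `|snr x - snr y| <= 6 * `|x - y|.
  move: hx hy => /andP[? ?] /andP[? ?]; apply: snr_lipschitz; try lra.
  by rewrite ler_norml; apply/andP; split; lra.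
have lb := bump_lipschitz R (2 ^+ k) x y; have b0 := bump_ge0 R (2 ^+ k) y.
rewrite /g (_ : _ - _ = (snr x - (2 * k)%:R) * (pbump R (2 ^+ k) x - pbump R (2 ^+ k) y) +
  (snr x - snr y) * pbump R (2 ^+ k) y); last by ring.
apply: (le_trans (ler_normD _ _)); rewrite !normrM [`|pbump _ _ y|]ger0_norm//.
rewrite (_ : (6 * C + 12) * _ = C * (6 * `|x - y|) + 6 * `|x - y| * 2); last by ring.
by apply: lerD; apply: ler_pM.
Qed.

(** A Riemann sum with a single node: the node is the left end of the interval, where the bump
    vanishes, so the integral itself is at most the error [L]. *)
Lemma excess_bounded : exists L : nat, forall k, `|excess k| <= L%:R.
Proof.
have [L hL] := g_lipschitz; exists L => k; rewrite excessE.
have := riemann_sum R (g k) (2 ^+ k) L%:R 0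
  (continuousM_bump R (2 ^+ k) _ (g_continuous k)) (hL k).
rewrite big_ord_recr big_ord0 /= mul0r addr0 add0r !divr1.
by rewrite /g /pbump subrr mulr0 mul0r max_l// mulr0 sub0r normrN.
Qed.

Lemma excess_computable : CR 1 (fun v => excess (head 0%N v)).
Proof.
have [L hL] := g_lipschitz.
(* With [L * 2 ^ n + 1] nodes the error [L / (L * 2 ^ n + 1)] is at most [2 ^- n], also when
   [L = 0]. *)
pose y n v := \sum_(j < (L * 2 ^ n).+1) g (head 0%N v)
   (2 ^+ head 0%N v + j%:R / (L * 2 ^ n).+1%:R) / (L * 2 ^ n).+1%:R.
apply: (CR_lim R y); last first.
  move=> n v _; rewrite excessE; set k := head 0%N v.
  apply: le_trans (riemann_sum R (g k) (2 ^+ k) L%:R (L * 2 ^ n)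
    (continuousM_bump R (2 ^+ k) _ (g_continuous k)) (hL k)) _.
  rewrite ler_pdivrMr// mulrC ler_pdivlMr ?exprn_gt0//.
  by rewrite -natrX -natrM ler_nat.
have rN j (f : seq nat -> nat) : rec j f -> rec j (fun v => (L * 2 ^ f v).+1).
  move=> rf; apply: rec_S; apply: rec_mul; first exact: rec_cst.
  by apply: rec_exp => //; exact: rec_cst.
apply: (CR_sum R (fun j v => g (head 0%N (behead v))
   (2 ^+ head 0%N (behead v) + j%:R / (L * 2 ^ head 0%N v).+1%:R) / (L * 2 ^ head 0%N v).+1%:R)
   (fun v => (L * 2 ^ head 0%N v).+1)); last exact/rN/rec_head.
have rn : rec 3 (fun v => head 0%N (behead v)) by exact/rec_weak/rec_head.
have rk : rec 3 (fun v => head 0%N (behead (behead v))).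
  exact/(rec_weak (fun v => head 0%N (behead v)))/rec_weak/rec_head.
have rI : RQ 3 (fun v => (L * 2 ^ head 0%N (behead v)).+1%:R^-1).
  by apply: RQ_inv; apply: RQ_nat; exact: rN.
have rA : RQ 3 (fun v => 2 ^+ head 0%N (behead (behead v))).
  apply: (RQ_ext _ (fun v => (2 ^ head 0 (behead (behead v)))%N%:R)).
    by move=> v _; rewrite natrX.
  by apply: RQ_nat; apply: rec_exp => //; exact: rec_cst.
have rx : RQ 3 (fun v => 2 ^+ head 0%N (behead (behead v)) +
    (head 0%N v)%:R / (L * 2 ^ head 0%N (behead v)).+1%:R).
  apply: RQ_add => //; apply: RQ_mul => //; apply: RQ_nat; exact: rec_head.
apply: CR_mul; last exact: CR_RQ.
apply: CR_mul; last exact/CR_RQ/RQ_pbump.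
apply: CR_add; first exact: CR_snr.
by apply: CR_opp; apply/CR_RQ/RQ_nat; apply: rec_mul => //; exact: rec_cst.
Qed.

End LogIntegral.

(** * Shifts by computable numbers, and the density for one channel *)

Lemma Sigma1_add x u : Sigma1 x -> computable_real u -> Sigma1 (x + u).
Proof.
move=> [r [/RQ_ratseq rr r_nd r_x]] [t [/RQ_ratseq rt t_u]].
(* From [n] to [n.+1] the approximation [t] may drop by [2 ^- n + 2 ^- n.+1], that is
   [3 * 2 ^- n.+1]; the correction term rises by exactly this amount and restores monotonicity. *)
exists (fun n => r n + t n - 3 * 2 ^- n); split.
- apply: (ratseq_RQ R (fun v => r (head 0%N v) + t (head 0%N v) - 3 * 2 ^- head 0%N v)).
  apply: RQ_add; first exact: RQ_add.
  apply: RQ_opp; apply: RQ_mul; first exact: (RQ_cst 3).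
  by apply: RQ_pow2N; exact: rec_head.
- move=> n; have := r_nd n; have := t_u n; have := t_u n.+1.
  rewrite pow2NS; move: (2 ^- n) => e; rewrite !ltr_norml => /andP[? ?] /andP[? ?] ?.
  lra.
- rewrite -[X in _ --> X]subr0; apply: cvgB; last exact: cvg_pow2N.
  apply: cvgD => //; apply: (cvg_geom _ _ 1) => n.
  by rewrite mul1r distrC ltW.
Qed.

Lemma Pi1_Sigma1N x : Pi1 x <-> Sigma1 (- x).
Proof.
split=> -[r [/RQ_ratseq rr r_m r_x]]; exists (fun n => - r n); split.
- by apply: (ratseq_RQ R (fun v => - r (head 0%N v))); exact: RQ_opp.
- by move=> n; rewrite lerN2.
- exact: cvgN.
- by apply: (ratseq_RQ R (fun v => - r (head 0%N v))); exact: RQ_opp.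
- by move=> n; rewrite lerN2.
- by rewrite -[x]opprK; exact: cvgN.
Qed.

(** The density is fixed before [P]: masses and positions come from [c] and [r], while [P] enters
    only through the excesses. *)
Lemma pdf_of_Sigma1 c s : Sigma1 c -> computable_real s -> 0 < s ->
  exists f : R -> R, [/\ cont_pdf f, computable_L1 f &
    forall P, computable_real P -> 0 < P ->
      mu.-integrable setT (fun x => (cap_integrand P s f x)%:E) /\
      exists u, computable_real u /\ cap_term P s f = c + u].
Proof.
move=> [r [/RQ_ratseq rr r_nd r_c]] s_comp s0.
have r_le n : r n <= c.
  rewrite -(cvg_lim _ r_c)//; apply: nondecreasing_cvgn_le; last exact: (cvgP _ r_c).
  exact/nondecreasing_seqP.
have r_ge0 n : r 0%N <= r n by elim: n => // n /le_trans; apply.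
(* The successor bounds [c - r 0] from above and keeps [Q] positive, as the division by [2 * k i]
   requires. *)
pose Q := (Num.truncn (c - r 0%N)).+1.
have Q_gt : c - r 0%N <= Q%:R by rewrite ltW// truncnS_gt.
pose q i := r i.+1 - r i.
have q_ge0 i : 0 <= q i by rewrite subr_ge0.
have q_le i : q i <= Q%:R.
  by apply: le_trans Q_gt; rewrite /q; have := r_le i.+1; have := r_ge0 i; lra.
pose k i := (Q * 2 ^ i)%N.
have k_gt0 i : 0 < (2 * k i)%:R :> R by rewrite ltr0n !muln_gt0 expn_gt0.
pose w i := q i / (2 * k i)%:R.
have w_ge0 i : 0 <= w i by rewrite divr_ge0.
have w_le i : w i <= 2 ^- i.+1.
  rewrite ler_pdivrMr// /k mulnCA -expnS natrM natrX mulrCA mulVf ?expf_neq0//.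
  by rewrite mulr1 q_le.
pose a i : R := 2 ^+ k i.
have rk1 : rec 1 (fun v => k (head 0%N v)).
  apply: rec_mul; first exact: rec_cst.
  by apply: rec_exp; [exact: rec_cst|exact: rec_head].
have a_RQ : RQ 1 (fun v => a (head 0%N v)).
  apply: (RQ_ext _ (fun v => (2 ^ k (head 0 v))%N%:R)).
    by move=> v _; rewrite natrX.
  by apply: RQ_nat; apply: rec_exp => //; exact: rec_cst.
have w_RQ : RQ 1 (fun v => w (head 0%N v)).
  apply: RQ_mul.
    apply: RQ_add; last exact: RQ_opp.
    apply: (RQ_subst _ _ (fun v => [:: (head 0%N v).+1]) rr).
    by apply: recsub_cons; [exact/rec_S/rec_head|exact: recsub_nil].
  by apply: RQ_inv; apply: RQ_nat; apply: rec_mul => //; exact: rec_cst.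
exists (density R a w); split; [exact: density_pdf|exact: density_computable|].
move=> P P_comp P0; pose E := excess P s.
have [L E_le] : exists L : nat, forall j, `|E j| <= L%:R by exact: excess_bounded.
have E_CR : CR 1 (fun v => E (head 0%N v)) by exact: excess_computable.
pose T := limn (fun n => \sum_(i < n) w i * E (k i)).
have T_le n : `|\sum_(i < n) w i * E (k i) - T| <= L%:R * 2 ^- n.
  apply: (geom_series R (fun i => w i * E (k i))) => i.
  by rewrite normrM ger0_norm// mulrC ler_pM.
have JE j : \int[mu]_x (snr P s x * pbump R (2 ^+ j) x) = E j + (2 * j)%:R.
  by rewrite /E /excess subrK.
have [Gi GE] : integral_is R (fun x => snr P s x * density R a w x)
    ((1 - mass R w) * E 0%N + (c - r 0%N + T)).
  have := integral_density R a w w_ge0 w_le (snr P s) (c - r 0%N + T)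
    (snr_continuous P s P0 s0) (snr_ge0 P s P0 s0).
  (* The bump at [1] is the one at [2 ^+ 0], where the main term [2 * 0] vanishes and only [E 0]
     remains. *)
  have := JE 0%N; rewrite expr0 muln0 addr0 => ->; apply.
  have -> : (fun n => \sum_(i < n) w i * \int[mu]_x (snr P s x * pbump R (a i) x)) =
      (fun n => (r n - r 0%N) + \sum_(i < n) w i * E (k i)).
    apply/funext => n; under eq_bigr do rewrite JE mulrDr.
    rewrite big_split /= addrC; congr (_ + _).
    (* As [w i * (2 * k i) = q i], the main terms telescope to [r n - r 0]. *)
    elim: n => [|n IH]; first by rewrite big_ord0 subrr.
    rewrite big_ord_recr /= IH /w divfK ?gt_eqF// /q; ring.
  apply: cvgD; first by apply: cvgB => //; exact: cvg_cst.
  exact: (cvg_geom _ _ L%:R).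
split; first exact: Gi.
exists ((1 - mass R w) * E 0%N - r 0%N + T); split; last first.
  rewrite /cap_term (_ : (\int[mu]_x _)%E =
    ((1 - mass R w) * E 0%N + (c - r 0%N + T))%:E)//=; ring.
have Ek : CR 1 (fun v => E (k (head 0%N v))).
  apply: (CR_subst _ _ (fun v => [:: k (head 0%N v)]) E_CR).
  by apply: recsub_cons => //; exact: recsub_nil.
have lift1 (x : nat -> R) : CR 1 (fun v => x (head 0%N v)) ->
    CR 2 (fun v => x (head 0%N v)).
  move=> cx; apply: (CR_subst _ _ (fun v => [:: head 0%N v]) cx).
  by apply: recsub_cons; [exact: rec_head|exact: recsub_nil].
have mass_CR : CR 0 (fun=> mass R w).
  apply: (CR_lim R (fun n _ => \sum_(i < n) w i)).
    apply: (CR_sum R (fun i _ => w i) (head 0%N)); last exact: rec_head.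
    exact/lift1/CR_RQ.
  move=> n _ _; have /andP[h1 h2] := massP R w w_ge0 w_le n.
  by rewrite distrC ger0_norm.
have T_CR : CR 0 (fun=> T).
  (* Summing [n + L] terms leaves a tail of at most [L * 2 ^- (n + L)], hence at most [2 ^- n]. *)
  apply: (CR_lim R (fun n _ => \sum_(i < n + L) w i * E (k i))).
    apply: (CR_sum R (fun i _ => w i * E (k i)) (fun v => head 0%N v + L)%N).
      by apply: CR_mul; [exact/lift1/CR_RQ|exact: (lift1 (fun i => E (k i)))].
    by apply: rec_add; [exact: rec_head|exact: rec_cst].
  by move=> n _ _; apply: le_trans (T_le _) (pow2N_mul R n L).
have E0_CR : CR 0 (fun=> E 0%N).
  apply: (CR_subst _ _ (fun=> [:: 0%N]) E_CR).
  by apply: recsub_cons; [exact: rec_cst|exact: recsub_nil].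
have r0_CR : CR 0 (fun=> r 0%N).
  apply: CR_RQ; apply: (RQ_subst _ _ (fun=> [:: 0%N]) rr).
  by apply: recsub_cons; [exact: rec_cst|exact: recsub_nil].
apply: real_CR; apply: CR_add => //; apply: CR_add; last exact: CR_opp.
apply: CR_mul => //; apply: CR_add; last exact: CR_opp.
exact/CR_RQ/(RQ_cst 1).
Qed.

End Computing.

(** * The secrecy capacity as a difference of two such integrals *)

Theorem theorem1 (x s1 s2 : Rdefinitions.R) :
  Delta2u x -> 0 < x -> ~ Sigma1 x -> ~ Pi1 x ->
  computable_real s1 -> computable_real s2 -> 0 < s1 -> 0 < s2 ->
  exists f1 f2 : Rdefinitions.R -> Rdefinitions.R,
    [/\ cont_pdf f1, cont_pdf f2, computable_L1 f1, computable_L1 f2 &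
     [/\
       (forall P, computable_real P -> 0 < P ->
         [/\ lebesgue_measure.-integrable setT
               (fun a => (cap_integrand P s1 f1 a)%:E),
             lebesgue_measure.-integrable setT
               (fun a => (cap_integrand P s2 f2 a)%:E) &
             exists u, computable_real u /\ C_S P f1 f2 s1 s2 = x + u]) &

       (forall P, computable_real P -> 0 < P ->
         [/\ Delta2u (C_S P f1 f2 s1 s2), ~ Sigma1 (C_S P f1 f2 s1 s2)
           & ~ Pi1 (C_S P f1 f2 s1 s2)])]].
Proof.
move=> [a [b [aS bS ->]]] _ nS nP s1c s2c s1p s2p.
have [f1 [pdf1 L1f1 F1]] := pdf_of_Sigma1 _ a s1 aS s1c s1p.
have [f2 [pdf2 L1f2 F2]] := pdf_of_Sigma1 _ b s2 bS s2c s2p.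
exists f1, f2; split => //; split => P Pc Pp;
  have [i1 [u1 [u1c E1]]] := F1 P Pc Pp; have [i2 [u2 [u2c E2]]] := F2 P Pc Pp.
  split => //; exists (u1 - u2); split; first exact: computable_realB.
  by rewrite /C_S E1 E2; ring.
have CE : C_S P f1 f2 s1 s2 = (a + u1) - (b + u2) by rewrite /C_S E1 E2.
(* Adding [u2 - u1] to the capacity gives back [a - b], so either membership of the capacity would
   transfer to [a - b]. *)
have uc := computable_realB _ _ _ u2c u1c.
split.
- by exists (a + u1), (b + u2); split => //; exact: Sigma1_add.
- move=> CS; apply: nS; have := Sigma1_add _ _ _ CS uc.
  by rewrite CE (_ : _ + _ = a - b)//; ring.
- move=> /Pi1_Sigma1N CP; apply/nP/Pi1_Sigma1N.
  have := Sigma1_add _ _ _ CP (computable_realN _ _ uc).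
  by rewrite CE (_ : _ + _ = - (a - b))//; ring.
Qed.
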